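(* Let $\beta=(\beta_n)_{n\ge0}$ be a bounded sequence of positive numbers with a polynomial minoration. Assume that for every $\delta>0$ there exists $C=C(\delta)>0$ such that $\beta_m\le C\beta_n$ whenever $m>(1+\delta)n$. Then for every symbol $\phi$ with $\phi(0)=0$, the composition operator $C_\phi$ is bounded on $H^2(\beta)$.
   Context: $H^2(\beta)$ is the Hilbert space of analytic functions $f(z)=\sum_{n\ge0}a_nz^n$ on the unit disk $\mathbb D$ with $\|f\|^2=\sum_{n\ge0}|a_n|^2\beta_n<\infty$. A symbol is a non-constant analytic map $\phi:\mathbb D\to\mathbb D$ and $C_\phi f=f\circ\phi$. $\beta$ has a polynomial minoration if there are constants $\delta,\alpha>0$ with $\beta_n\ge\delta n^{-\alpha}$ for all $n\ge1$. *)

(* Defs.v *)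
From Stdlib Require Import Reals.
From Coquelicot Require Import Coquelicot.
Open Scope R_scope.

Definition in_disk (z : C) : Prop := Cmod z < 1.

Definition taylor_on_disk (f : C -> C) (a : nat -> C) : Prop :=
  forall z : C, in_disk z -> is_pseries a z (f z).

Definition analytic_on_disk (f : C -> C) : Prop :=
  exists a : nat -> C, taylor_on_disk f a.

Definition symbol (phi : C -> C) : Prop :=
  analytic_on_disk phi /\
  (forall z, in_disk z -> in_disk (phi z)) /\
  (exists z1 z2, in_disk z1 /\ in_disk z2 /\ phi z1 <> phi z2).

Definition wterm (beta : nat -> R) (a : nat -> C) (n : nat) : R :=
  (Cmod (a n))^2 * beta n.

Definition in_H2 (beta : nat -> R) (f : C -> C) (a : nat -> C) : Prop :=
  taylor_on_disk f a /\ ex_series (wterm beta a).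

Definition H2_norm2 (beta : nat -> R) (a : nat -> C) : R :=
  Series (wterm beta a).

Definition poly_minoration (beta : nat -> R) : Prop :=
  exists delta alpha : R, 0 < delta /\ 0 < alpha /\
    forall n : nat, (1 <= n)%nat -> delta * Rpower (INR n) (- alpha) <= beta n.

Definition comp_bounded (beta : nat -> R) (phi : C -> C) : Prop :=
  exists M : R, 0 <= M /\
    forall (f : C -> C) (a : nat -> C), in_H2 beta f a ->
      exists b : nat -> C, in_H2 beta (fun z => f (phi z)) b /\
        H2_norm2 beta b <= M * H2_norm2 beta a.

(* Main.v *)
Require Import Defs.
From Stdlib Require Import Reals Lra Lia Arith.
From Coquelicot Require Import Coquelicot.
Open Scope R_scope.

(** Let [A m n] be the coefficient of [z^m] in [phi^n]; as [phi 0 = 0], [A] is lower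
    triangular. By Littlewood's subordination principle [A] is a contraction of [l^2]
    (multiplication by [phi] contracts [H^2], which follows from Parseval over roots of
    unity). If [|phi'(0)| = 1], then [phi] is a rotation and [A] is diagonal. Otherwise
    [|A m n| <= (r rho)^n / rho^m] with [r, rho < 1], so for small [d] the band
    [m <= (1 + d) n] of [A] is exponentially small; since [beta] is bounded and decays
    subexponentially, this band is Hilbert-Schmidt both on [l^2] and on the weighted space.
    The rest of [A], supported on [m > (1 + d) n], is therefore bounded on [l^2], and there
    [beta m <= C beta n], so Kacnel'son's Abel summation argument for triangular matrices
    passes to the weighted norm. *)

(** * Finite sums, convergence and Cauchy products in C *)

(** The gap condition controls [beta m / beta n] when [m] exceeds [n] by a fixed factor; for [m]
    close to [n] the weight may oscillate and the quotient need not stay bounded. So Kacnel'son's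
    argument cannot be run on the whole triangular matrix, and the band near the diagonal is removed
    first. The argument starts from an unweighted bound on what remains, which is known only as [A]
    minus the band: this is why the band is needed on l^2 as well as on the weighted space. The
    width d is dictated by the bound (r rho)^n / rho^m: at m = (1 + d) n it equals (r rho^(-d))^n,
    which decays geometrically as soon as rho^d > r. Geometric decay then beats the polynomial lower
    bound on beta. Operator bounds are stated for finite sections, with constants independent of the
    sizes, and pass to series at the end. *)

Definition Csum (u : nat -> C) (n : nat) : C := sum_n u n.

Lemma Csum_0 u : Csum u 0 = u 0%nat.
Proof. apply sum_O. Qed.

Lemma Csum_S u n : Csum u (S n) = (Csum u n + u (S n))%C.
Proof. apply (sum_Sn u n). Qed.

Lemma Csum_ext u v n :
  (forall k, (k <= n)%nat -> u k = v k) -> Csum u n = Csum v n.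
Proof. intro H; now apply sum_n_ext_loc. Qed.

Lemma Csum_plus u v n :
  Csum (fun k => (u k + v k)%C) n = (Csum u n + Csum v n)%C.
Proof. apply (sum_n_plus u v n). Qed.

Lemma Csum_mult_l a u n : Csum (fun k => (a * u k)%C) n = (a * Csum u n)%C.
Proof. apply (sum_n_mult_l (K := C_Ring) a u n). Qed.

Lemma Csum_mult_r a u n : Csum (fun k => (u k * a)%C) n = (Csum u n * a)%C.
Proof. apply (sum_n_mult_r (K := C_Ring) a u n). Qed.

Lemma Csum_minus u v n :
  Csum (fun k => (u k - v k)%C) n = (Csum u n - Csum v n)%C.
Proof.
induction n as [|n IH]; rewrite ?Csum_0, ?Csum_S; [reflexivity|].
rewrite IH; ring.
Qed.

Lemma Csum_switch (u : nat -> nat -> C) m n :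
  Csum (fun i => Csum (u i) n) m = Csum (fun j => Csum (fun i => u i j) m) n.
Proof. apply (sum_n_switch u m n). Qed.

Lemma Csum_conj u n : Cconj (Csum u n) = Csum (fun k => Cconj (u k)) n.
Proof.
induction n as [|n IH]; rewrite ?Csum_0, ?Csum_S; [reflexivity|].
now rewrite Cplus_conj, IH.
Qed.

Lemma Csum_RtoC (u : nat -> R) n :
  RtoC (sum_f_R0 u n) = Csum (fun k => RtoC (u k)) n.
Proof.
induction n as [|n IH]; rewrite ?Csum_0, ?Csum_S; [reflexivity|].
simpl; now rewrite RtoC_plus, IH.
Qed.

Lemma Csum_zero (u : nat -> C) n : (forall k, (k <= n)%nat -> u k = 0%C) -> Csum u n = 0%C.
Proof.
induction n as [|n IH]; intro H; rewrite ?Csum_0, ?Csum_S; [apply H; lia|].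
rewrite IH, H by (intros; try apply H; lia); ring.
Qed.

Lemma Csum_single (u : nat -> C) n i :
  (i <= n)%nat -> (forall k, (k <= n)%nat -> k <> i -> u k = 0%C) ->
  Csum u n = u i.
Proof.
induction n as [|n IH]; intros Hi H; rewrite ?Csum_0, ?Csum_S.
- now replace i with 0%nat by lia.
- destruct (Nat.eq_dec i (S n)) as [->|E].
  + rewrite Csum_zero by (intros; apply H; lia); ring.
  + rewrite IH, (H (S n)) by (intros; try apply H; lia); ring.
Qed.

Lemma Csum_extend (u : nat -> C) n N :
  (n <= N)%nat -> (forall k, (n < k)%nat -> u k = 0%C) -> Csum u N = Csum u n.
Proof.
intros HN H; induction HN as [|N HN IH]; [reflexivity|].
rewrite Csum_S, IH, H by lia; ring.
Qed.

Lemma Cmod_Csum u n : Cmod (Csum u n) <= sum_f_R0 (fun k => Cmod (u k)) n.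
Proof.
induction n as [|n IH]; rewrite ?Csum_0, ?Csum_S; simpl; [lra|].
eapply Rle_trans; [apply Cmod_triangle|lra].
Qed.

Lemma Cmod_Csum_diff u n N : (n <= N)%nat ->
  Cmod (Csum u N - Csum u n) <=
  sum_f_R0 (fun k => Cmod (u k)) N - sum_f_R0 (fun k => Cmod (u k)) n.
Proof.
intro H; induction H as [|N H IH].
- replace (Csum u n - Csum u n)%C with (RtoC 0) by ring.
  rewrite Cmod_0; lra.
- rewrite Csum_S; simpl.
  replace (Csum u N + u (S N) - Csum u n)%C
    with ((Csum u N - Csum u n) + u (S N))%C by ring.
  eapply Rle_trans; [apply Cmod_triangle|lra].
Qed.

Lemma Csum_Re u n : Re (Csum u n) = sum_f_R0 (fun k => Re (u k)) n.
Proof.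
induction n as [|n IH]; rewrite ?Csum_0, ?Csum_S; [reflexivity|].
simpl; now rewrite <- IH.
Qed.

Lemma Csum_Im u n : Im (Csum u n) = sum_f_R0 (fun k => Im (u k)) n.
Proof.
induction n as [|n IH]; rewrite ?Csum_0, ?Csum_S; [reflexivity|].
simpl; now rewrite <- IH.
Qed.

(** * Convergence in epsilon form, and Cauchy products *)

Definition Ccv (s : nat -> C) (l : C) : Prop :=
  forall eps, 0 < eps -> exists N, forall n, (N <= n)%nat -> Cmod (s n - l) < eps.

Lemma filterlim_Ccv (s : nat -> C) (l : C) :
  filterlim s eventually (locally l) <-> Ccv s l.
Proof.
split.
- intros H eps He.
  apply (proj1 (filterlim_locally_ball_norm (U := C_NormedModule) s l) H
           (mkposreal eps He)).
- intros H; apply (filterlim_locally_ball_norm (U := C_NormedModule) s l).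
  intros eps; apply (H eps (cond_pos eps)).
Qed.

Lemma is_pseries_Ccv (a : nat -> C) (z l : C) :
  is_pseries a z l <-> Ccv (Csum (fun k => (z ^ k * a k)%C)) l.
Proof. apply filterlim_Ccv. Qed.

Lemma Ccv_ext s t l : (forall n, s n = t n) -> Ccv s l -> Ccv t l.
Proof.
intros H Hs eps He; destruct (Hs eps He) as [N HN]; exists N.
intros n Hn; rewrite <- H; auto.
Qed.

Lemma Ccv_unique s l1 l2 : Ccv s l1 -> Ccv s l2 -> l1 = l2.
Proof.
intros H1 H2.
replace l1 with (l2 + (l1 - l2))%C by ring.
rewrite (Cmod_eq_0 (l1 - l2)); [ring|].
apply Rle_antisym; [|apply Cmod_ge_0].
apply le_epsilon; intros eps He.
destruct (H1 (eps / 2)) as [N1 HN1]; [lra|].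
destruct (H2 (eps / 2)) as [N2 HN2]; [lra|].
specialize (HN1 (N1 + N2)%nat ltac:(lia)); specialize (HN2 (N1 + N2)%nat ltac:(lia)).
set (x := s (N1 + N2)%nat) in *.
replace (l1 - l2)%C with ((x - l2) + - (x - l1))%C by ring.
eapply Rle_trans; [apply Cmod_triangle|rewrite Cmod_opp; lra].
Qed.

Lemma Ccv_eventually_const s l N :
  (forall n, (N <= n)%nat -> s n = l) -> Ccv s l.
Proof.
intros H eps He; exists N; intros n Hn; rewrite H by lia.
replace (l - l)%C with (RtoC 0) by ring; now rewrite Cmod_0.
Qed.

Lemma Ccv_plus s t l1 l2 :
  Ccv s l1 -> Ccv t l2 -> Ccv (fun n => (s n + t n)%C) (l1 + l2)%C.
Proof.
intros H1 H2 eps He.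
destruct (H1 (eps / 2)) as [N1 HN1]; [lra|].
destruct (H2 (eps / 2)) as [N2 HN2]; [lra|].
exists (N1 + N2)%nat; intros n Hn.
specialize (HN1 n ltac:(lia)); specialize (HN2 n ltac:(lia)).
replace (s n + t n - (l1 + l2))%C with ((s n - l1) + (t n - l2))%C by ring.
eapply Rle_lt_trans; [apply Cmod_triangle|lra].
Qed.

Lemma Ccv_scal a s l : Ccv s l -> Ccv (fun n => (a * s n)%C) (a * l)%C.
Proof.
intros H eps He.
pose proof (Cmod_ge_0 a) as Ha.
destruct (H (eps / (Cmod a + 1))) as [N HN]; [apply Rdiv_lt_0_compat; lra|].
exists N; intros n Hn; specialize (HN n Hn).
replace (a * s n - a * l)%C with (a * (s n - l))%C by ring.
rewrite Cmod_mult.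
pose proof (Cmod_ge_0 (s n - l)).
apply Rle_lt_trans with ((Cmod a + 1) * Cmod (s n - l)); [nra|].
apply Rlt_le_trans with ((Cmod a + 1) * (eps / (Cmod a + 1))).
- apply Rmult_lt_compat_l; lra.
- right; field; lra.
Qed.

Lemma Ccv_Csum (s : nat -> nat -> C) (l : nat -> C) N :
  (forall n, (n <= N)%nat -> Ccv (s n) (l n)) ->
  Ccv (fun L => Csum (fun n => s n L) N) (Csum l N).
Proof.
induction N as [|N IH]; intro H.
- apply Ccv_ext with (s 0%nat); [intro; now rewrite Csum_0|].
  rewrite Csum_0; apply H; lia.
- apply Ccv_ext with (fun L => (Csum (fun n => s n L) N + s (S N) L)%C).
  { intro; now rewrite Csum_S. }
  rewrite Csum_S; apply Ccv_plus; [apply IH; intros; apply H; lia|apply H; lia].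
Qed.

Lemma Ccv_Re_Im s l :
  Ccv s l <->
  is_lim_seq (fun n => Re (s n)) (Re l) /\ is_lim_seq (fun n => Im (s n)) (Im l).
Proof.
split.
- intro H; split; apply is_lim_seq_spec; intros eps;
    destruct (H eps (cond_pos eps)) as [N HN]; exists N; intros n Hn;
    specialize (HN n Hn).
  + eapply Rle_lt_trans; [|apply HN].
    eapply Rle_trans; [|apply re_le_Cmod]; right; reflexivity.
  + eapply Rle_lt_trans; [|apply HN].
    eapply Rle_trans; [|apply Rmax_Cmod].
    eapply Rle_trans; [|apply Rmax_r]; right; reflexivity.
- intros [H1 H2] eps He.
  apply is_lim_seq_spec in H1; apply is_lim_seq_spec in H2.
  assert (He2 : 0 < eps / 2) by lra.
  destruct (H1 (mkposreal _ He2)) as [N1 HN1].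
  destruct (H2 (mkposreal _ He2)) as [N2 HN2].
  exists (N1 + N2)%nat; intros n Hn.
  specialize (HN1 n ltac:(lia)); specialize (HN2 n ltac:(lia)); simpl in HN1, HN2.
  replace (s n - l)%C with (RtoC (Re (s n) - Re l) + Ci * RtoC (Im (s n) - Im l))%C.
2:{ destruct (s n) as [x y]; destruct l as [u v].
    apply injective_projections; simpl; ring. }
eapply Rle_lt_trans; [apply Cmod_triangle|].
rewrite Cmod_mult, Cmod_Ci, !Cmod_R; lra.
Qed.

Definition conv (a b : nat -> C) (m : nat) : C :=
  Csum (fun k => (a k * b (m - k)%nat)%C) m.

Lemma is_series_sum_f_R0 (u : nat -> R) (l : R) :
  is_series u l <-> is_lim_seq (sum_f_R0 u) l.
Proof.
split; intro H.
- apply is_lim_seq_ext with (sum_n u); [apply sum_n_Reals|exact H].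
- change (is_lim_seq (sum_n u) l).
  apply (is_lim_seq_ext (sum_f_R0 u) (sum_n u)); [|exact H].
  intro; symmetry; apply sum_n_Reals.
Qed.

(** The real and imaginary parts of a complex Cauchy product combine four real ones, each covered by
    [is_series_mult]; absolute convergence passes to both parts because they are dominated by
    [Cmod]. *)
Lemma Ccv_conv a b la lb :
  Ccv (Csum a) la -> Ccv (Csum b) lb ->
  ex_series (fun n => Cmod (a n)) -> ex_series (fun n => Cmod (b n)) ->
  Ccv (Csum (conv a b)) (la * lb)%C.
Proof.
intros Ha Hb Sa Sb.
assert (Rea : forall u, ex_series (fun n => Cmod (u n)) ->
          ex_series (fun n => Rabs (Re (u n)))).
{ intros u Hu.
  apply (ex_series_le (V := R_CompleteNormedModule) _ (fun n => Cmod (u n))); [|exact Hu].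
  intro n; unfold norm; simpl; unfold abs; simpl; rewrite Rabs_Rabsolu; apply re_le_Cmod. }
assert (Ima : forall u, ex_series (fun n => Cmod (u n)) ->
          ex_series (fun n => Rabs (Im (u n)))).
{ intros u Hu.
  apply (ex_series_le (V := R_CompleteNormedModule) _ (fun n => Cmod (u n))); [|exact Hu].
  intro n; unfold norm; simpl; unfold abs; simpl; rewrite Rabs_Rabsolu.
  eapply Rle_trans; [|apply Rmax_Cmod]; apply Rmax_r. }
apply Ccv_Re_Im in Ha; apply Ccv_Re_Im in Hb.
destruct Ha as [Ha1 Ha2], Hb as [Hb1 Hb2].
assert (P : forall u v lu lv, is_lim_seq (sum_f_R0 u) (Finite lu) ->
   is_lim_seq (sum_f_R0 v) (Finite lv) ->
   ex_series (fun n => Rabs (u n)) -> ex_series (fun n => Rabs (v n)) ->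
   is_lim_seq (sum_f_R0 (fun n => sum_f_R0 (fun k => u k * v (n - k)%nat) n)) (lu * lv)).
{ intros u v lu lv H1 H2 H3 H4; apply is_series_sum_f_R0.
  apply is_series_mult; try assumption; now apply is_series_sum_f_R0. }
assert (E1 : is_lim_seq (sum_f_R0 (fun n => Re (a n))) (Re la)).
{ eapply is_lim_seq_ext; [|apply Ha1]; intro; apply Csum_Re. }
assert (E2 : is_lim_seq (sum_f_R0 (fun n => Im (a n))) (Im la)).
{ eapply is_lim_seq_ext; [|apply Ha2]; intro; apply Csum_Im. }
assert (E3 : is_lim_seq (sum_f_R0 (fun n => Re (b n))) (Re lb)).
{ eapply is_lim_seq_ext; [|apply Hb1]; intro; apply Csum_Re. }
assert (E4 : is_lim_seq (sum_f_R0 (fun n => Im (b n))) (Im lb)).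
{ eapply is_lim_seq_ext; [|apply Hb2]; intro; apply Csum_Im. }
apply Ccv_Re_Im; split.
- apply is_lim_seq_ext with (fun N =>
    sum_f_R0 (fun n => sum_f_R0 (fun k => Re (a k) * Re (b (n - k)%nat)) n) N -
    sum_f_R0 (fun n => sum_f_R0 (fun k => Im (a k) * Im (b (n - k)%nat)) n) N).
  + intro N; rewrite Csum_Re, <- minus_sum; apply sum_eq; intros n _.
    unfold conv; rewrite Csum_Re, <- minus_sum; now apply sum_eq.
  + apply is_lim_seq_minus'; [apply (P (fun n => Re (a n)) (fun n => Re (b n)))|apply (P (fun n => Im (a n)) (fun n => Im (b n)))]; auto.
- apply is_lim_seq_ext with (fun N =>
    sum_f_R0 (fun n => sum_f_R0 (fun k => Re (a k) * Im (b (n - k)%nat)) n) N +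
    sum_f_R0 (fun n => sum_f_R0 (fun k => Im (a k) * Re (b (n - k)%nat)) n) N).
  + intro N; rewrite Csum_Im, <- plus_sum; apply sum_eq; intros n _.
    unfold conv; rewrite Csum_Im, <- plus_sum; now apply sum_eq.
  + apply is_lim_seq_plus'; [apply (P (fun n => Re (a n)) (fun n => Im (b n)))|apply (P (fun n => Im (a n)) (fun n => Re (b n)))]; auto.
Qed.

Lemma conv_ext_le a a' b b' m :
  (forall k, (k <= m)%nat -> a k = a' k) -> (forall k, (k <= m)%nat -> b k = b' k) ->
  conv a b m = conv a' b' m.
Proof.
intros Ha Hb; apply Csum_ext; intros k Hk; rewrite Ha, Hb by lia; reflexivity.
Qed.

Lemma conv_geom a b (z : C) m :
  conv (fun k => (z ^ k * a k)%C) (fun k => (z ^ k * b k)%C) m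
  = (z ^ m * conv a b m)%C.
Proof.
unfold conv; rewrite <- Csum_mult_l; apply Csum_ext; intros k Hk.
replace (z ^ m)%C with (z ^ k * z ^ (m - k))%C
  by (rewrite <- Cpow_add_r; f_equal; lia).
ring.
Qed.

Definition trunc (n : nat) (a : nat -> C) (k : nat) : C :=
  if Nat.leb k n then a k else 0%C.

Lemma trunc_le n a k : (k <= n)%nat -> trunc n a k = a k.
Proof. intro H; unfold trunc; now rewrite (proj2 (Nat.leb_le k n) H). Qed.

Lemma trunc_gt n a k : (n < k)%nat -> trunc n a k = 0%C.
Proof. intro H; unfold trunc; now rewrite (proj2 (Nat.leb_gt k n) H). Qed.

Lemma conv_trunc_gt n1 n2 a b m :
  (n1 + n2 < m)%nat -> conv (trunc n1 a) (trunc n2 b) m = 0%C.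
Proof.
intro H; apply Csum_zero; intros k Hk.
destruct (le_lt_dec k n1) as [H1|H1].
- rewrite (trunc_gt n2) by lia; ring.
- rewrite (trunc_gt n1) by lia; ring.
Qed.

Lemma ex_series_trunc n a : ex_series (fun k => Cmod (trunc n a k)).
Proof.
exists (sum_f_R0 (fun k => Cmod (trunc n a k)) n); apply is_series_sum_f_R0.
apply is_lim_seq_ext_loc with (fun _ => sum_f_R0 (fun k => Cmod (trunc n a k)) n).
- exists n; intros N HN; induction HN as [|N HN IH]; [reflexivity|].
  simpl; rewrite <- IH, trunc_gt, Cmod_0 by lia; ring.
- apply is_lim_seq_const.
Qed.

(** Product of two polynomials at the point 1. Instead of reindexing a double sum, both sides are
    identified as limits of the same eventually constant Cauchy product. *)
Lemma Csum_conv_trunc n1 n2 a b :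
  Csum (conv (trunc n1 a) (trunc n2 b)) (n1 + n2) = (Csum a n1 * Csum b n2)%C.
Proof.
assert (T : forall n u, Ccv (Csum (trunc n u)) (Csum u n)).
{ intros n u; apply Ccv_eventually_const with n; intros N HN.
  rewrite (Csum_extend _ n N) by (auto; intros; apply trunc_gt; lia).
  apply Csum_ext; intros; now apply trunc_le. }
apply (Ccv_unique (Csum (conv (trunc n1 a) (trunc n2 b)))).
- apply Ccv_eventually_const with (n1 + n2)%nat; intros N HN.
  apply Csum_extend; auto; intros; now apply conv_trunc_gt.
- apply Ccv_conv; auto using ex_series_trunc.
Qed.

(** * Roots of unity, discrete Parseval, and multiplication by a bounded polynomial *)

Definition expi (x : R) : C := (cos x, sin x).

Lemma expi_0 : expi 0 = RtoC 1.
Proof. unfold expi, RtoC; now rewrite cos_0, sin_0. Qed.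

Lemma expi_plus x y : expi (x + y) = (expi x * expi y)%C.
Proof.
unfold expi, Cmult; simpl; rewrite cos_plus, sin_plus; f_equal; ring.
Qed.

Lemma expi_pow x n : (expi x ^ n)%C = expi (INR n * x).
Proof.
induction n as [|n IH].
- simpl; now rewrite Rmult_0_l, expi_0.
- rewrite Cpow_S, IH, <- expi_plus, S_INR; f_equal; ring.
Qed.

Lemma Cconj_expi x : Cconj (expi x) = expi (- x).
Proof. unfold expi, Cconj; simpl; now rewrite cos_neg, sin_neg. Qed.

Lemma Cmod_expi x : Cmod (expi x) = 1.
Proof.
unfold Cmod, expi; simpl.
replace (cos x * (cos x * 1) + sin x * (sin x * 1)) with 1; [apply sqrt_1|].
pose proof (sin2_cos2 x); unfold Rsqr in *; lra.
Qed.

Lemma expi_2PI_nat n : expi (INR n * (2 * PI)) = RtoC 1.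
Proof.
unfold expi, RtoC.
rewrite <- (Rplus_0_l (INR n * (2 * PI))).
replace (0 + INR n * (2 * PI)) with (0 + 2 * INR n * PI) by ring.
now rewrite cos_period, sin_period, cos_0, sin_0.
Qed.

Lemma expi_neq_1 x : x <> 0 -> Rabs x < 2 * PI -> expi x <> RtoC 1.
Proof.
intros Hx Hb E; unfold expi, RtoC in E; injection E as Ec Es.
assert (H : forall y, 0 < y -> y < 2 * PI -> cos y <> 1).
{ intros y H0 H1 Hc; replace y with (2 * (y / 2)) in Hc by field.
  rewrite cos_2a_sin in Hc.
  assert (0 < sin (y / 2)) by (apply sin_gt_0; lra); nra. }
destruct (Rle_lt_dec x 0) as [H0|H0].
- rewrite Rabs_left1 in Hb by lra.
  apply (H (- x)); try lra; now rewrite cos_neg.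
- rewrite Rabs_right in Hb by lra; apply (H x); lra.
Qed.

Lemma Csum_geom (u : C) n : ((u - 1) * Csum (fun j => (u ^ j)%C) n = u ^ S n - 1)%C.
Proof.
induction n as [|n IH]; rewrite ?Csum_0, ?Csum_S.
- simpl; ring.
- rewrite Cmult_plus_distr_l, IH, !Cpow_S; ring.
Qed.

Definition root_unity (n : nat) : C := expi (2 * PI / INR n).

(** For [m <> l] this is a geometric sum whose ratio [u] satisfies [u ^ S n = 1]; since
    [|m - l| <= n], the angle of [u] is nonzero and less than a full turn, so [u <> 1] and the sum
    vanishes. *)
Lemma root_unity_orthogonal n m l : (m <= n)%nat -> (l <= n)%nat ->
  Csum (fun j => ((root_unity (S n) ^ m * Cconj (root_unity (S n) ^ l)) ^ j)%C) n
  = if Nat.eq_dec m l then RtoC (INR (S n)) else RtoC 0.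
Proof.
intros Hm Hl; unfold root_unity.
rewrite !expi_pow, Cconj_expi, <- expi_plus.
set (th := 2 * PI / INR (S n)).
pose proof (lt_0_INR (S n) ltac:(lia)) as HN; pose proof PI_RGT_0 as HPI.
assert (Hth : INR (S n) * th = 2 * PI) by (unfold th; field; lra).
assert (Hth0 : 0 < th) by (unfold th; apply Rdiv_lt_0_compat; lra).
destruct (Nat.eq_dec m l) as [<-|Hne].
- replace (INR m * th + - (INR m * th)) with 0 by ring; rewrite expi_0.
  rewrite (Csum_ext _ (fun _ => RtoC 1)) by (intros; apply Cpow_1_l).
  clear; induction n as [|n IH]; rewrite ?Csum_0, ?Csum_S; [reflexivity|].
  rewrite IH, (S_INR (S n)), RtoC_plus; reflexivity.
- set (u := expi _).
  assert (Hu : (u ^ S n)%C = RtoC 1).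
  { unfold u; rewrite expi_pow.
    replace (INR (S n) * (INR m * th + - (INR l * th)))
      with (INR m * (INR (S n) * th) + - (INR l * (INR (S n) * th))) by ring.
    rewrite Hth, expi_plus, <- Cconj_expi, !expi_2PI_nat.
    apply injective_projections; simpl; ring. }
  assert (Hu1 : u <> RtoC 1).
  { apply expi_neq_1.
    - assert (INR m <> INR l) by (intro E; apply Hne; now apply INR_eq).
      intro E; assert ((INR m - INR l) * th = 0) by lra; nra.
    - replace (INR m * th + - (INR l * th)) with ((INR m - INR l) * th) by ring.
      rewrite Rabs_mult, (Rabs_right th) by lra; rewrite <- Hth.
      apply Rmult_lt_compat_r; [lra|].
      apply le_INR in Hm; apply le_INR in Hl; rewrite S_INR.
      pose proof (pos_INR m); pose proof (pos_INR l).
      apply Rabs_def1; lra. }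
  pose proof (Csum_geom u n) as G; rewrite Hu in G.
  assert (Hd : (u - 1)%C <> RtoC 0).
  { intro E; apply Hu1; replace u with ((u - 1) + 1)%C by ring; rewrite E; ring. }
  replace (RtoC 1 - RtoC 1)%C with (RtoC 0) in G by ring.
  destruct (Ceq_dec (Csum (fun j => (u ^ j)%C) n) 0) as [E|E]; [exact E|].
  exfalso; exact (Cmult_neq_0 _ _ Hd E G).
Qed.

(** A polynomial of degree at most [n] sampled at [n + 1] roots of unity satisfies Parseval exactly,
    so no integral over the circle is required. *)
Lemma discrete_parseval (g : nat -> C) n :
  sum_f_R0 (fun j => Cmod (Csum (fun m =>
    ((root_unity (S n) ^ j) ^ m * g m)%C) n) ^ 2) n
  = INR (S n) * sum_f_R0 (fun m => Cmod (g m) ^ 2) n.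
Proof.
set (w := root_unity (S n)).
apply RtoC_inj; rewrite Csum_RtoC, RtoC_mult, Csum_RtoC.
rewrite (Csum_ext _ (fun j => Csum (fun m => Csum (fun l =>
  ((g m * Cconj (g l)) * (w ^ m * Cconj (w ^ l)) ^ j)%C) n) n)).
2:{ intros j _; rewrite Cmod2_conj, Csum_conj, <- Csum_mult_r.
    apply Csum_ext; intros m _; rewrite <- Csum_mult_l.
    apply Csum_ext; intros l _.
    rewrite !Cmult_conj, Cpow_mult_l, !Cpow_conj, <- !Cpow_mult_r.
    rewrite (Nat.mul_comm m j), (Nat.mul_comm l j); ring. }
rewrite Csum_switch, <- Csum_mult_l; apply Csum_ext; intros m Hm.
rewrite Csum_switch.
rewrite (Csum_single _ n m); auto.
- rewrite Csum_mult_l; unfold w; rewrite root_unity_orthogonal by lia.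
  destruct (Nat.eq_dec m m) as [_|E]; [|congruence].
  rewrite Cmod2_conj; ring.
- intros l Hl Hne; rewrite Csum_mult_l; unfold w.
  rewrite root_unity_orthogonal by lia.
  destruct (Nat.eq_dec m l) as [E|_]; [congruence|ring].
Qed.

Lemma sum_f_R0_le_extend (u : nat -> R) n N :
  (forall k, 0 <= u k) -> (n <= N)%nat -> sum_f_R0 u n <= sum_f_R0 u N.
Proof.
intros Hu H; induction H as [|N H IH]; [lra|].
simpl; specialize (Hu (S N)); lra.
Qed.

Lemma sum_f_R0_extend (u : nat -> R) n N :
  (n <= N)%nat -> (forall k, (n < k)%nat -> u k = 0) ->
  sum_f_R0 u N = sum_f_R0 u n.
Proof.
intros H Hu; induction H as [|N H IH]; [reflexivity|].
simpl; rewrite IH, Hu by lia; ring.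
Qed.

Lemma sqnorm_ge_0 (z : C) : 0 <= Cmod z ^ 2.
Proof. apply pow2_ge_0. Qed.

(** Parseval turns multiplication by [p] into pointwise multiplication at roots of unity, where [p]
    is at most [B]. The truncated product has degree at most [K + M], hence the choice of [L];
    [M <= K] ensures that truncating [p] leaves the coefficients up to [M] unchanged. *)
Lemma poly_mult_contraction (p h : nat -> C) B K M :
  (M <= K)%nat -> 0 <= B ->
  (forall z, Cmod z = 1 -> Cmod (Csum (fun k => (z ^ k * p k)%C) K) <= B) ->
  sum_f_R0 (fun m => Cmod (conv p h m) ^ 2) M
  <= B ^ 2 * sum_f_R0 (fun m => Cmod (h m) ^ 2) M.
Proof.
intros HM HB Hp; set (L := (K + M)%nat); set (w := root_unity (S L)).
set (q := conv (trunc K p) (trunc M h)).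
pose proof (lt_0_INR (S L) ltac:(lia)) as HL.
apply Rle_trans with (sum_f_R0 (fun m => Cmod (q m) ^ 2) L).
{ apply Rle_trans with (sum_f_R0 (fun m => Cmod (q m) ^ 2) M).
  - right; apply sum_eq; intros m Hm; unfold q.
    rewrite (conv_ext_le (trunc K p) p (trunc M h) h); auto;
      intros; apply trunc_le; lia.
  - apply sum_f_R0_le_extend; [intro; apply sqnorm_ge_0|lia]. }
assert (Hh : sum_f_R0 (fun m => Cmod (h m) ^ 2) M =
             sum_f_R0 (fun m => Cmod (trunc M h m) ^ 2) L).
{ rewrite (sum_f_R0_extend _ M L); [|lia|].
  - apply sum_eq; intros; now rewrite trunc_le.
  - intros; rewrite trunc_gt, Cmod_0 by lia; ring. }
apply Rmult_le_reg_l with (INR (S L)); [exact HL|].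
rewrite <- discrete_parseval; rewrite Hh.
replace (INR (S L) * (B ^ 2 * sum_f_R0 (fun m => Cmod (trunc M h m) ^ 2) L))
  with (B ^ 2 * (INR (S L) * sum_f_R0 (fun m => Cmod (trunc M h m) ^ 2) L)) by ring.
rewrite <- discrete_parseval, scal_sum.
apply sum_Rle; intros j _; fold w.
replace (Csum (fun m => ((w ^ j) ^ m * q m)%C) L)
  with (Csum (fun k => ((w ^ j) ^ k * p k)%C) K *
        Csum (fun m => ((w ^ j) ^ m * trunc M h m)%C) L)%C.
- rewrite Cmod_mult, Rpow_mult_distr, Rmult_comm.
  apply Rmult_le_compat_l; [apply sqnorm_ge_0|].
  apply pow_incr; split; [apply Cmod_ge_0|].
  apply Hp; rewrite Cmod_pow; unfold w, root_unity; rewrite Cmod_expi; apply pow1.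
- rewrite (Csum_extend _ M L) by (try lia; intros; rewrite trunc_gt by lia; ring).
  rewrite <- Csum_conv_trunc; fold L; apply Csum_ext; intros m _.
  unfold q; rewrite <- conv_geom; apply conv_ext_le; intros k _; unfold trunc;
    destruct (k <=? K)%nat, (k <=? M)%nat; ring.
Qed.

(** * Littlewood subordination on coefficients *)

Lemma taylor_Cmod_bounded f a r : taylor_on_disk f a -> 0 <= r < 1 ->
  exists B, 0 <= B /\ forall k, Cmod (a k) * r ^ k <= B.
Proof.
intros Ht Hr.
assert (Hd : in_disk (RtoC r)).
{ unfold in_disk; rewrite Cmod_R, Rabs_right; lra. }
destruct (filterlim_bounded (V := C_NormedModule)
            (Csum (fun k => (RtoC r ^ k * a k)%C))) as [B HB].
{ exists (f (RtoC r)); apply (Ht _ Hd). }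
change (forall n, Cmod (Csum (fun k => (RtoC r ^ k * a k)%C) n) <= B) in HB.
exists (B + B); split.
- pose proof (HB 0%nat); pose proof (Cmod_ge_0 (Csum (fun k => (RtoC r ^ k * a k)%C) 0)).
  lra.
- intro k.
  replace (Cmod (a k) * r ^ k) with (Cmod (RtoC r ^ k * a k)%C).
  2:{ rewrite Cmod_mult, Cmod_pow, Cmod_R, Rabs_right by lra; ring. }
  destruct k as [|k].
  + pose proof (HB 0%nat) as H0; rewrite Csum_0 in H0.
    pose proof (Cmod_ge_0 (RtoC r ^ 0 * a 0%nat)); lra.
  + pose proof (HB k) as H0; pose proof (HB (S k)) as H1.
    set (s := Csum (fun k => (RtoC r ^ k * a k)%C)) in *.
    replace (RtoC r ^ S k * a (S k))%C with (s (S k) + - s k)%C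
      by (unfold s; rewrite Csum_S; ring).
    eapply Rle_trans; [apply Cmod_triangle|rewrite Cmod_opp; lra].
Qed.

Lemma taylor_ex_series_Cmod f a r : taylor_on_disk f a -> 0 <= r < 1 ->
  ex_series (fun k => Cmod (a k) * r ^ k).
Proof.
intros Ht Hr.
set (t := (1 + r) / 2).
destruct (taylor_Cmod_bounded f a t Ht) as [B [HB0 HB]]; [unfold t; lra|].
assert (Htp : 0 < t) by (unfold t; lra).
apply (ex_series_le (V := R_CompleteNormedModule) _ (fun k => B * (r / t) ^ k)).
- intro k; unfold norm; simpl; unfold abs; simpl.
  pose proof (pow_le r k ltac:(lra)) as Hrk.
  rewrite Rabs_right by (apply Rle_ge, Rmult_le_pos; [apply Cmod_ge_0|lra]).
  unfold Rdiv; rewrite Rpow_mult_distr, pow_inv.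
  pose proof (pow_lt t k Htp).
  replace (Cmod (a k) * r ^ k) with (Cmod (a k) * t ^ k * (r ^ k * / t ^ k))
    by (field; lra).
  apply Rmult_le_compat_r; [|apply HB].
  apply Rmult_le_pos; [lra|]; left; now apply Rinv_0_lt_compat.
- apply (ex_series_scal_l B (fun k => (r / t) ^ k)), ex_series_geom.
  rewrite Rabs_right.
  + apply Rmult_lt_reg_r with t; [lra|].
    unfold Rdiv; rewrite Rmult_assoc, Rinv_l; unfold t; lra.
  + apply Rle_ge, Rmult_le_pos; [lra|]; left; now apply Rinv_0_lt_compat.
Qed.

(** Absolute convergence on the circle of radius [r] bounds the Taylor tail uniformly in [z], so one
    [K] serves the whole circle. [M <= K] is what [poly_mult_contraction] asks for. *)
Lemma self_map_partial_sum_le phi c r eps M :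
  taylor_on_disk phi c -> (forall z, in_disk z -> in_disk (phi z)) ->
  0 <= r < 1 -> 0 < eps ->
  exists K, (M <= K)%nat /\ forall z, Cmod z = 1 ->
    Cmod (Csum (fun k => (z ^ k * (RtoC r ^ k * c k))%C) K) <= 1 + eps.
Proof.
intros Ht Hm Hr He.
destruct (taylor_ex_series_Cmod phi c r Ht Hr) as [T HT].
apply is_series_sum_f_R0, is_lim_seq_spec in HT.
assert (He4 : 0 < eps / 4) by lra.
destruct (HT (mkposreal _ He4)) as [N HN]; simpl in HN.
exists (M + N)%nat; split; [lia|]; intros z Hz.
set (K := (M + N)%nat).
set (u := fun k => (z ^ k * (RtoC r ^ k * c k))%C).
assert (Hd : in_disk (RtoC r * z)%C).
{ unfold in_disk; rewrite Cmod_mult, Cmod_R, Hz, Rabs_right; lra. }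
pose proof (proj1 (is_pseries_Ccv _ _ _) (Ht _ Hd)) as Hs.
(* This [N1] depends on [z], but it is only used to reach an auxiliary index [n] at which the
   partial sum is close to [phi]; [K] is already fixed. *)
destruct (Hs (eps / 4) He4) as [N1 HN1].
set (n := (K + N1)%nat).
specialize (HN1 n ltac:(unfold n; lia)).
rewrite (Csum_ext _ u) in HN1
  by (intros k _; unfold u; rewrite Cpow_mult_l; ring).
pose proof (Cmod_Csum_diff u K n ltac:(unfold n; lia)) as Hdiff.
assert (Eu : forall j, sum_f_R0 (fun k => Cmod (u k)) j =
                       sum_f_R0 (fun k => Cmod (c k) * r ^ k) j).
{ intro j; apply sum_eq; intros k _; unfold u.
  rewrite !Cmod_mult, !Cmod_pow, Hz, pow1, Cmod_R, Rabs_right by lra; ring. }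
rewrite !Eu in Hdiff.
pose proof (Rabs_def2 _ _ (HN K ltac:(unfold K; lia))) as [Ha Ha'].
pose proof (Rabs_def2 _ _ (HN n ltac:(unfold n, K; lia))) as [Hb Hb'].
pose proof (Hm _ Hd) as Hphi; unfold in_disk in Hphi.
set (p := phi (RtoC r * z)%C) in *.
replace (Csum u K) with (p + ((Csum u n - p) + - (Csum u n - Csum u K)))%C by ring.
eapply Rle_trans; [apply Cmod_triangle|].
pose proof (Cmod_triangle (Csum u n - p) (- (Csum u n - Csum u K))) as H3.
rewrite Cmod_opp in H3; lra.
Qed.

Lemma sum_f_R0_scal_l (a : R) u n :
  sum_f_R0 (fun k => a * u k) n = a * sum_f_R0 u n.
Proof. rewrite scal_sum; apply sum_eq; intros; ring. Qed.

(** Contractivity on H^2 of multiplication by the series [c], in finite sections: coefficients of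
    the product up to [M] depend only on those of [h] up to [M], so [h] can be any sequence. *)
Definition l2_contraction (c : nat -> C) : Prop :=
  forall h M, sum_f_R0 (fun m => Cmod (conv c h m) ^ 2) M
              <= sum_f_R0 (fun m => Cmod (h m) ^ 2) M.

Lemma self_map_l2_contraction phi c :
  taylor_on_disk phi c -> (forall z, in_disk z -> in_disk (phi z)) ->
  l2_contraction c.
Proof.
intros Ht Hm h M.
set (S0 := sum_f_R0 (fun m => Cmod (conv c h m) ^ 2) M).
set (H0 := sum_f_R0 (fun m => Cmod (h m) ^ 2) M).
assert (HS0 : 0 <= S0) by (apply cond_pos_sum; intro; apply sqnorm_ge_0).
assert (HH0 : 0 <= H0) by (apply cond_pos_sum; intro; apply sqnorm_ge_0).
(* Dilating by [r] makes the series of [phi] absolutely convergent on the circle. As [M] is fixed,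
   the loss is at most the factor [r ^ (2 * M)], which tends to 1. *)
assert (key : forall r eps, 0 < r < 1 -> 0 < eps ->
          r ^ (2 * M) * S0 <= (1 + eps) ^ 2 * H0).
{ intros r eps Hr He.
  destruct (self_map_partial_sum_le phi c r eps M Ht Hm) as [K [HK HB]]; try lra.
  pose proof (poly_mult_contraction (fun k => (RtoC r ^ k * c k)%C)
    (fun k => (RtoC r ^ k * h k)%C) (1 + eps) K M HK ltac:(lra) HB) as P.
  assert (Q : sum_f_R0 (fun m => Cmod (RtoC r ^ m * h m) ^ 2) M <= H0).
  { apply sum_Rle; intros k _.
    rewrite Cmod_mult, Cmod_pow, Cmod_R, Rabs_right by lra.
    apply pow_incr; split; [apply Rmult_le_pos; [apply pow_le; lra|apply Cmod_ge_0]|].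
    rewrite <- (Rmult_1_l (Cmod (h k))) at 2.
    apply Rmult_le_compat_r; [apply Cmod_ge_0|].
    rewrite <- (pow1 k); apply pow_incr; lra. }
  apply Rle_trans with (2 := Rmult_le_compat_l _ _ _ (pow2_ge_0 (1 + eps)) Q).
  eapply Rle_trans; [|exact P].
  unfold S0; rewrite <- sum_f_R0_scal_l; apply sum_Rle; intros m Hmm.
  rewrite conv_geom, Cmod_mult, Rpow_mult_distr, Cmod_pow, Cmod_R, Rabs_right by lra.
  apply Rmult_le_compat_r; [apply sqnorm_ge_0|].
  rewrite <- pow_mult.
  replace (2 * M)%nat with (m * 2 + (2 * M - m * 2))%nat by lia.
  rewrite pow_add; rewrite <- (Rmult_1_r (r ^ (m * 2))) at 2.
  apply Rmult_le_compat_l; [apply pow_le; lra|].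
  rewrite <- (pow1 (2 * M - m * 2)); apply pow_incr; lra. }
assert (L : is_lim_seq (fun n => / INR (n + 2)) 0).
{ apply (is_lim_seq_incr_n (fun n => / INR n) 2).
  replace (Finite 0) with (Rbar_inv p_infty) by reflexivity.
  apply is_lim_seq_inv; [apply is_lim_seq_INR|discriminate]. }
(* One sequence drives both limits, with [1 - r = eps = / INR (n + 2)]; the shift by 2 keeps [r]
   strictly between 0 and 1. *)
apply (is_lim_seq_le (fun n => (1 - / INR (n + 2)) ^ (2 * M) * S0)
         (fun n => (1 + / INR (n + 2)) ^ 2 * H0) S0 H0).
- intro n.
  assert (0 < / INR (n + 2) < 1).
  { assert (1 < INR (n + 2)) by (rewrite plus_INR; pose proof (pos_INR n); simpl; lra).
    split; [apply Rinv_0_lt_compat; lra|].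
    rewrite <- Rinv_1; apply Rinv_lt_contravar; lra. }
  apply key; lra.
- assert (C1 : continuous (fun x => (1 - x) ^ (2 * M) * S0) 0).
  { apply (ex_derive_continuous (fun x => (1 - x) ^ (2 * M) * S0)); auto_derive; auto. }
  replace (Finite S0) with (Finite ((1 - 0) ^ (2 * M) * S0))
    by (rewrite Rminus_0_r, pow1, Rmult_1_l; reflexivity).
  eapply (is_lim_seq_continuous (fun x => (1 - x) ^ (2 * M) * S0)); [|exact L].
  apply continuity_pt_filterlim; exact C1.
- assert (C1 : continuous (fun x => (1 + x) ^ 2 * H0) 0).
  { apply (ex_derive_continuous (fun x => (1 + x) ^ 2 * H0)); auto_derive; auto. }
  replace (Finite H0) with (Finite ((1 + 0) ^ 2 * H0))
    by (f_equal; ring).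
  eapply (is_lim_seq_continuous (fun x => (1 + x) ^ 2 * H0)); [|exact L].
  apply continuity_pt_filterlim; exact C1.
Qed.

(* [powcoef c n m] is the coefficient of [z^m] in the [n]-th power of [sum_k c k z^k]. *)
Fixpoint powcoef (c : nat -> C) (n : nat) : nat -> C :=
  match n with
  | O => fun m => match m with O => RtoC 1 | S _ => RtoC 0 end
  | S n' => conv c (powcoef c n')
  end.

Lemma conv_one_r c m : conv c (powcoef c 0) m = c m.
Proof.
unfold conv; rewrite (Csum_single _ m m); auto.
- rewrite Nat.sub_diag; simpl; ring.
- intros k Hk Hne; destruct (m - k)%nat eqn:E; [lia|simpl; ring].
Qed.

Lemma sum_f_R0_powcoef_0 c (x : R) M :
  sum_f_R0 (fun m => Cmod (powcoef c 0 m) ^ 2 * x) M = x.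
Proof.
induction M as [|M IH]; simpl.
- rewrite Cmod_1; ring.
- simpl in IH; rewrite IH, Cmod_0; ring.
Qed.

Lemma powcoef_sqnorm_le c n M : l2_contraction c ->
  sum_f_R0 (fun m => Cmod (powcoef c n m) ^ 2) M <= 1.
Proof.
intro Hc; induction n as [|n IH].
- right; rewrite <- (sum_f_R0_powcoef_0 c 1 M); apply sum_eq; intros; ring.
- simpl; eapply Rle_trans; [apply Hc|exact IH].
Qed.

Lemma term_le_sum (u : nat -> R) n i :
  (forall k, 0 <= u k) -> (i <= n)%nat -> u i <= sum_f_R0 u n.
Proof.
intros Hu Hi; apply Rle_trans with (sum_f_R0 u i);
  [|now apply sum_f_R0_le_extend].
destruct i; simpl; [lra|].
pose proof (cond_pos_sum u i Hu); lra.
Qed.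

Lemma powcoef_le_1 c n m : l2_contraction c -> Cmod (powcoef c n m) <= 1.
Proof.
intro Hc; pose proof (powcoef_sqnorm_le c n m Hc) as H.
pose proof (term_le_sum (fun m => Cmod (powcoef c n m) ^ 2) m m
             (fun _ => sqnorm_ge_0 _) (le_n _)) as H1; cbv beta in H1.
pose proof (Cmod_ge_0 (powcoef c n m)); nra.
Qed.

Lemma powcoef_lower c n m : c 0%nat = RtoC 0 -> (m < n)%nat -> powcoef c n m = RtoC 0.
Proof.
intro H0; revert m; induction n as [|n IH]; intros m Hm; [lia|].
simpl; apply Csum_zero; intros [|k] Hk.
- rewrite H0; ring.
- rewrite IH by lia; ring.
Qed.

(** Induction by Cauchy products; the coefficients of every power are at most 1 in modulus, so a
    geometric series in [Cmod z] gives the absolute convergence. *)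
Lemma powcoef_pseries phi c n z :
  taylor_on_disk phi c -> l2_contraction c -> in_disk z ->
  Ccv (Csum (fun m => (z ^ m * powcoef c n m)%C)) (phi z ^ n)%C.
Proof.
intros Ht Hc Hz; induction n as [|n IH].
- apply Ccv_eventually_const with 0%nat; intros N _.
  rewrite (Csum_single _ N 0) by
    first [lia | intros [|k] _ Hk; [lia|simpl; ring]].
  simpl; ring.
- apply Ccv_ext with (Csum (conv (fun k => (z ^ k * c k)%C)
                                 (fun k => (z ^ k * powcoef c n k)%C))).
  { intro N; apply Csum_ext; intros m _; apply conv_geom. }
  rewrite Cpow_S.
  assert (G : forall u, (forall k, Cmod (u k) <= 1) ->
            ex_series (fun k => Cmod (z ^ k * u k)%C)).
  { intros u Hu.
    apply (ex_series_le (V := R_CompleteNormedModule) _ (fun k => Cmod z ^ k)).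
    - intro k; unfold norm; simpl; unfold abs; simpl.
      rewrite Rabs_right, Cmod_mult, Cmod_pow by (apply Rle_ge, Cmod_ge_0).
      pose proof (pow_le (Cmod z) k (Cmod_ge_0 z)); specialize (Hu k); nra.
    - apply ex_series_geom; rewrite Rabs_right; [exact Hz|apply Rle_ge, Cmod_ge_0]. }
  apply Ccv_conv; auto.
  + now apply is_pseries_Ccv, Ht.
  + apply G; intro k; rewrite <- conv_one_r; apply (powcoef_le_1 c 1 k Hc).
  + apply G; intro k; now apply powcoef_le_1.
Qed.

(* The coefficient of [z^m] in [sum_(n <= N) x n phi^n]. *)
Definition compcoef (c x : nat -> C) (N m : nat) : C :=
  Csum (fun n => (powcoef c n m * x n)%C) N.

Lemma Csum_shift (u : nat -> C) n :
  Csum u (S n) = (u 0%nat + Csum (fun k => u (S k)) n)%C.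
Proof.
induction n as [|n IH]; [now rewrite Csum_S, !Csum_0|].
rewrite Csum_S, IH, (Csum_S (fun k => u (S k))); ring.
Qed.

Lemma compcoef_S c x N m :
  compcoef c x (S N) m =
  (powcoef c 0 m * x 0%nat + conv c (compcoef c (fun n => x (S n)) N) m)%C.
Proof.
unfold compcoef at 1; rewrite Csum_shift; f_equal.
unfold conv, compcoef.
rewrite (Csum_ext _ (fun n => Csum (fun k =>
   (c k * powcoef c n (m - k)%nat * x (S n))%C) m)).
2:{ intros n _; rewrite Csum_mult_r; reflexivity. }
rewrite Csum_switch; apply Csum_ext; intros k _.
rewrite <- Csum_mult_l; apply Csum_ext; intros; ring.
Qed.

(* By peeling off the constant term of the input:
   f o phi = f(0) + phi * (g o phi) where f = f(0) + z g. *)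
Lemma littlewood_subordination c x N M :
  l2_contraction c -> c 0%nat = RtoC 0 ->
  sum_f_R0 (fun m => Cmod (compcoef c x N m) ^ 2) M
  <= sum_f_R0 (fun n => Cmod (x n) ^ 2) N.
Proof.
intros Hc H0; revert x; induction N as [|N IH]; intro x.
- right; change (sum_f_R0 (fun n => Cmod (x n) ^ 2) 0) with (Cmod (x 0%nat) ^ 2).
  rewrite <- (sum_f_R0_powcoef_0 c (Cmod (x 0%nat) ^ 2) M).
  apply sum_eq; intros m _; unfold compcoef.
  now rewrite Csum_0, Cmod_mult, Rpow_mult_distr.
- set (y := compcoef c (fun n => x (S n)) N).
  (* As [c 0 = 0], the constant term and the product with [phi] occupy disjoint degrees, so their
     squared moduli add without a cross term. *)
  rewrite (sum_eq _ (fun m => Cmod (powcoef c 0 m) ^ 2 * Cmod (x 0%nat) ^ 2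
                              + Cmod (conv c y m) ^ 2)).
  + rewrite plus_sum, sum_f_R0_powcoef_0, (decomp_sum _ (S N)) by lia.
    apply Rplus_le_compat_l; simpl pred.
    eapply Rle_trans; [apply Hc|apply IH].
  + intros [|m] _; rewrite compcoef_S; fold y.
    * replace (conv c y 0) with (RtoC 0)
        by (unfold conv; rewrite Csum_0, H0; ring).
      simpl powcoef; rewrite Cmod_0, Cmod_1.
      replace (RtoC 1 * x 0%nat + RtoC 0)%C with (x 0%nat) by ring; ring.
    * simpl powcoef; rewrite Cmod_0.
      replace (RtoC 0 * x 0%nat + conv c y (S m))%C with (conv c y (S m)) by ring; ring.
Qed.

(** * Decay of the coefficients of powers, and the rotation case *)

(** Cauchy's estimate for the [n]-th power on the circle of radius [rho], with the supremum of the
    symbol replaced by its majorant series; this form follows by induction from the convolution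
    alone. *)
Lemma powcoef_majorant c rho s n m :
  0 < rho -> (forall k, sum_f_R0 (fun k => Cmod (c k) * rho ^ k) k <= s) ->
  Cmod (powcoef c n m) * rho ^ m <= s ^ n.
Proof.
intros Hr Hs.
assert (Hs0 : 0 <= s).
{ eapply Rle_trans; [|apply (Hs 0%nat)]; simpl.
  pose proof (Cmod_ge_0 (c 0%nat)); lra. }
revert m; induction n as [|n IH]; intro m.
- destruct m; simpl; [rewrite Cmod_1|rewrite Cmod_0]; lra.
- simpl powcoef; unfold conv.
  apply Rle_trans with
    (sum_f_R0 (fun k => s ^ n * (Cmod (c k) * rho ^ k)) m).
  + rewrite Rmult_comm; eapply Rle_trans.
    { apply Rmult_le_compat_l; [apply pow_le; lra|apply Cmod_Csum]. }
    rewrite <- sum_f_R0_scal_l; apply sum_Rle; intros k Hk.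
    rewrite Cmod_mult; replace m with (k + (m - k))%nat at 1 by lia.
    rewrite pow_add.
    replace (rho ^ k * rho ^ (m - k) * (Cmod (c k) * Cmod (powcoef c n (m - k))))
      with ((Cmod (powcoef c n (m - k)) * rho ^ (m - k)) * (Cmod (c k) * rho ^ k))
      by ring.
    apply Rmult_le_compat_r; [|apply IH].
    apply Rmult_le_pos; [apply Cmod_ge_0|apply pow_le; lra].
  + rewrite sum_f_R0_scal_l; simpl; rewrite (Rmult_comm s).
    apply Rmult_le_compat_l; [now apply pow_le|apply Hs].
Qed.

(** A quantitative strict Schwarz lemma: near 0 the linear term dominates, and its slope is less
    than 1. *)
Lemma schwarz_majorant c :
  l2_contraction c -> c 0%nat = RtoC 0 -> Cmod (c 1%nat) < 1 ->
  exists rho r, 0 < rho < 1 /\ 0 < r < 1 /\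
    forall k, sum_f_R0 (fun k => Cmod (c k) * rho ^ k) k <= r * rho.
Proof.
intros Hc H0 H1; pose proof (Cmod_ge_0 (c 1%nat)) as H1'.
(* Put [a = Cmod (c 1)]. Coefficients are at most 1 and [rho <= 1/4], so the terms of degree at
   least 2 total at most [2 rho^2]; with this [rho], [a rho + 2 rho^2] is exactly
   [(1 + a) / 2 * rho]. *)
exists ((1 - Cmod (c 1%nat)) / 4), ((1 + Cmod (c 1%nat)) / 2).
repeat split; try lra.
set (rho := (1 - Cmod (c 1%nat)) / 4).
assert (Hr : 0 < rho <= / 4) by (unfold rho; lra).
replace ((1 + Cmod (c 1%nat)) / 2 * rho)
  with (Cmod (c 1%nat) * rho + 2 * rho ^ 2) by (unfold rho; field).
intros [|k].
- simpl; rewrite H0, Cmod_0; nra.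
(* The subtracted [2 rho^(k+2)] reserves room for the remaining tail and makes the induction close,
   because [rho <= 1/2]. *)
- assert (B : sum_f_R0 (fun k => Cmod (c k) * rho ^ k) (S k)
              <= Cmod (c 1%nat) * rho + 2 * rho ^ 2 - 2 * rho ^ (k + 2)).
  { induction k as [|k IH].
    - simpl; rewrite H0, Cmod_0; lra.
    - replace (sum_f_R0 (fun k => Cmod (c k) * rho ^ k) (S (S k)))
        with (sum_f_R0 (fun k => Cmod (c k) * rho ^ k) (S k)
              + Cmod (c (S (S k))) * rho ^ (S (S k))) by reflexivity.
      assert (Hk : Cmod (c (S (S k))) <= 1)
        by (rewrite <- conv_one_r; apply (powcoef_le_1 c 1 _ Hc)).
      replace (k + 2)%nat with (S (S k)) in IH by lia.
      replace (S k + 2)%nat with (S (S (S k))) by lia.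
      pose proof (pow_lt rho (S (S k)) ltac:(lra)).
      replace (rho ^ S (S (S k))) with (rho * rho ^ S (S k)) by reflexivity.
      nra. }
  pose proof (pow_lt rho (k + 2) ltac:(lra)); lra.
Qed.

(** The squared moduli of the coefficients of [phi] sum to at most 1, and the coefficient of degree
    1 already uses all of it. *)
Lemma unimodular_derivative_rotation c k :
  l2_contraction c -> c 0%nat = RtoC 0 -> Cmod (c 1%nat) = 1 ->
  k <> 1%nat -> c k = RtoC 0.
Proof.
intros Hc H0 H1 Hk; destruct k as [|[|k]]; [exact H0|lia|].
apply Cmod_eq_0.
assert (H : sum_f_R0 (fun m => Cmod (c m) ^ 2) (S (S k)) <= 1).
{ eapply Rle_trans; [|apply (powcoef_sqnorm_le c 1 (S (S k)) Hc)].
  right; apply sum_eq; intros m _; simpl powcoef; now rewrite <- conv_one_r. }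
change (sum_f_R0 (fun m => Cmod (c m) ^ 2) (S k) + Cmod (c (S (S k))) ^ 2 <= 1) in H.
pose proof (term_le_sum (fun m => Cmod (c m) ^ 2) (S k) 1
             (fun _ => sqnorm_ge_0 _) ltac:(lia)) as H2.
cbv beta in H2; rewrite H1 in H2; pose proof (Cmod_ge_0 (c (S (S k)))); nra.
Qed.

Lemma rotation_powcoef_diag c n m :
  (forall k, k <> 1%nat -> c k = RtoC 0) -> m <> n -> powcoef c n m = RtoC 0.
Proof.
intro Hc; revert m; induction n as [|n IH]; intros m Hm.
- destruct m; [lia|reflexivity].
- simpl; apply Csum_zero; intros k Hk; destruct (Nat.eq_dec k 1) as [->|E].
  + rewrite IH by lia; ring.
  + rewrite Hc by auto; ring.
Qed.

(** * Weighted estimates *)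

(** The form in which the polynomial minoration is used, both for the band and for point
    evaluations: [beta] decays more slowly than any geometric sequence. *)
Definition subexponential (beta : nat -> R) : Prop :=
  forall t, 0 < t < 1 -> exists K, 0 < K /\ forall n, t ^ n <= K * beta n.

Lemma exp_INR_mult n x : exp (INR n * x) = exp x ^ n.
Proof.
induction n as [|n IH].
- now rewrite Rmult_0_l, exp_0.
- rewrite S_INR, Rmult_plus_distr_r, Rmult_1_l, exp_plus, IH; simpl; ring.
Qed.

Lemma exp_monotone x y : x <= y -> exp x <= exp y.
Proof.
intros [H| ->]; [left; now apply exp_increasing|right; reflexivity].
Qed.

Lemma poly_minoration_subexponential beta :
  (forall n, 0 < beta n) -> poly_minoration beta -> subexponential beta.
Proof.
intros Hb (d & al & Hd & Hal & H) t Ht.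
assert (Hlt : ln t < 0) by (rewrite <- ln_1; apply ln_increasing; lra).
(* With [al * s = - ln t], the inequality [ln y <= y - 1] at [y = n * s] gives
   [n ln t <= - al ln n - al ln s], whence the constant [K]. *)
set (s := - ln t / al).
assert (Hs : 0 < s) by (unfold s; apply Rdiv_lt_0_compat; lra).
set (K := exp (- al * ln s) / d).
assert (HK : 0 < K) by (unfold K; apply Rdiv_lt_0_compat; [apply exp_pos|lra]).
pose proof (Rinv_0_lt_compat _ (Hb 0%nat)) as Hi.
(* The added [/ beta 0] covers [n = 0], about which the minoration says nothing. *)
exists (K + / beta 0%nat); split; [lra|].
intros [|n].
- rewrite Rmult_plus_distr_r, Rinv_l by (apply Rgt_not_eq, Hb).
  pose proof (Rmult_lt_0_compat _ _ HK (Hb 0%nat)); simpl; lra.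
- apply Rle_trans with (K * beta (S n)).
  2:{ pose proof (Hb (S n)); nra. }
  pose proof (lt_0_INR (S n) ltac:(lia)) as HN.
  apply Rle_trans with (K * (d * Rpower (INR (S n)) (- al))).
  2:{ apply Rmult_le_compat_l; [lra|apply H; lia]. }
  replace (K * (d * Rpower (INR (S n)) (- al)))
    with (exp (- al * ln s + - al * ln (INR (S n))))
    by (rewrite exp_plus; unfold K, Rpower; field; lra).
  rewrite <- (exp_ln t) at 1 by lra; rewrite <- exp_INR_mult; apply exp_monotone.
  pose proof (exp_ineq1_le (ln (INR (S n) * s))) as E.
  rewrite exp_ln in E by (apply Rmult_lt_0_compat; lra).
  rewrite ln_mult in E by lra.
  replace (ln t) with (- (al * s)) by (unfold s; field; lra).
  nra.
Qed.

Lemma geom_sum_le q n : 0 <= q < 1 -> sum_f_R0 (fun k => q ^ k) n <= / (1 - q).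
Proof.
intro Hq; rewrite tech3 by lra; unfold Rdiv.
rewrite <- (Rmult_1_l (/ (1 - q))) at 2; apply Rmult_le_compat_r.
- left; apply Rinv_0_lt_compat; lra.
- pose proof (pow_le q (S n) ltac:(lra)); lra.
Qed.

Lemma weighted_Cauchy_Schwarz (u v w : nat -> R) n : (forall k, 0 < w k) ->
  sum_f_R0 (fun k => u k * v k) n ^ 2
  <= sum_f_R0 (fun k => u k ^ 2 / w k) n * sum_f_R0 (fun k => w k * v k ^ 2) n.
Proof.
intro Hw; induction n as [|n IH].
- simpl sum_f_R0; right; field; apply Rgt_not_eq, Hw.
- rewrite !tech5.
  assert (HA : 0 <= sum_f_R0 (fun k => u k ^ 2 / w k) n).
  { apply cond_pos_sum; intro k; apply Rmult_le_pos; [apply pow2_ge_0|].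
    left; apply Rinv_0_lt_compat, Hw. }
  assert (HB : 0 <= sum_f_R0 (fun k => w k * v k ^ 2) n).
  { apply cond_pos_sum; intro k; apply Rmult_le_pos; [|apply pow2_ge_0].
    left; apply Hw. }
  set (A := sum_f_R0 (fun k => u k ^ 2 / w k) n) in *.
  set (D := sum_f_R0 (fun k => w k * v k ^ 2) n) in *.
  set (S0 := sum_f_R0 (fun k => u k * v k) n) in *.
  pose proof (Hw (S n)) as Hwn.
  (* [x] and [y] are the cross terms of the expanded product. The induction hypothesis bounds the
     square of the left cross product by [x * y], and the arithmetic-geometric inequality then
     bounds its double by [x + y]. *)
  set (x := A * (w (S n) * v (S n) ^ 2)); set (y := u (S n) ^ 2 / w (S n) * D).
  assert (Hx : 0 <= x).
  { unfold x; apply Rmult_le_pos; [lra|]; apply Rmult_le_pos; [lra|apply pow2_ge_0]. }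
  assert (Hy : 0 <= y).
  { unfold y; apply Rmult_le_pos; [|lra]; apply Rmult_le_pos; [apply pow2_ge_0|].
    left; now apply Rinv_0_lt_compat. }
  assert (Hxy : (S0 * (u (S n) * v (S n))) ^ 2 <= x * y).
  { replace (x * y) with (A * D * (u (S n) * v (S n)) ^ 2)
      by (unfold x, y; field; lra).
    rewrite Rpow_mult_distr; apply Rmult_le_compat_r; [apply pow2_ge_0|exact IH]. }
  assert (H2 : 2 * (S0 * (u (S n) * v (S n))) <= x + y).
  { revert Hxy Hx Hy; generalize (S0 * (u (S n) * v (S n))) x y.
    clear; intros p x y Hxy Hx Hy.
    apply Rsqr_incr_0_var; [|lra]; pose proof (pow2_ge_0 (x - y)); unfold Rsqr; nra. }
  assert (Hz : u (S n) ^ 2 / w (S n) * (w (S n) * v (S n) ^ 2)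
               = (u (S n) * v (S n)) ^ 2) by (field; lra).
  rewrite Rmult_plus_distr_l, !Rmult_plus_distr_r, Hz; fold x y; nra.
Qed.

(** The entries are dominated by a rank-one matrix. Cauchy-Schwarz in [n] costs the sum of
    [q^(2n) / beta n], at most [K] times that of [q^n]; in [m], [beta m <= B] and [q^(2m) <= q^m]
    leave another geometric sum. *)
Lemma geometric_matrix_bounded (e : nat -> nat -> C) (beta : nat -> R) B K q x N M :
  0 < q < 1 -> 0 < K -> (forall n, 0 < beta n) -> (forall n, beta n <= B) ->
  (forall n, q ^ n <= K * beta n) ->
  (forall m n, Cmod (e m n) <= q ^ m * q ^ n) ->
  sum_f_R0 (fun m => beta m * Cmod (Csum (fun n => (e m n * x n)%C) N) ^ 2) M
  <= B * K / (1 - q) ^ 2 * sum_f_R0 (fun n => beta n * Cmod (x n) ^ 2) N.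
Proof.
intros Hq HK Hb HB Hsub He.
set (X := sum_f_R0 (fun n => beta n * Cmod (x n) ^ 2) N).
assert (HX : 0 <= X).
{ apply cond_pos_sum; intro n; apply Rmult_le_pos; [left; apply Hb|apply sqnorm_ge_0]. }
assert (Hg : 0 < / (1 - q)) by (apply Rinv_0_lt_compat; lra).
assert (HB0 : 0 < B) by (pose proof (Hb 0%nat); pose proof (HB 0%nat); lra).
assert (Y : sum_f_R0 (fun n => q ^ n * Cmod (x n)) N ^ 2 <= K / (1 - q) * X).
{ eapply Rle_trans; [apply (weighted_Cauchy_Schwarz _ _ beta _ Hb)|].
  apply Rmult_le_compat_r; [exact HX|].
  apply Rle_trans with (K * sum_f_R0 (fun n => q ^ n) N).
  - rewrite <- sum_f_R0_scal_l; apply sum_Rle; intros n _.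
    pose proof (Hb n); pose proof (Hsub n); pose proof (pow_lt q n ltac:(lra)).
    apply Rmult_le_reg_r with (beta n); [lra|].
    replace ((q ^ n) ^ 2 / beta n * beta n) with (q ^ n * q ^ n) by (field; lra).
    replace (K * q ^ n * beta n) with (q ^ n * (K * beta n)) by ring.
    apply Rmult_le_compat_l; lra.
  - apply Rmult_le_compat_l; [lra|apply geom_sum_le; lra]. }
apply Rle_trans with
  (sum_f_R0 (fun m => (B * (K / (1 - q) * X)) * q ^ m) M).
- apply sum_Rle; intros m _.
  assert (Z : Cmod (Csum (fun n => (e m n * x n)%C) N)
              <= q ^ m * sum_f_R0 (fun n => q ^ n * Cmod (x n)) N).
  { eapply Rle_trans; [apply Cmod_Csum|].
    rewrite <- sum_f_R0_scal_l; apply sum_Rle; intros n _.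
    rewrite Cmod_mult, <- Rmult_assoc.
    apply Rmult_le_compat_r; [apply Cmod_ge_0|apply He]. }
  apply Rle_trans with (B * (q ^ m * (K / (1 - q) * X))).
  2:{ right; ring. }
  apply Rmult_le_compat; [left; apply Hb|apply sqnorm_ge_0|apply HB|].
  eapply Rle_trans; [apply pow_incr; split; [apply Cmod_ge_0|exact Z]|].
  rewrite Rpow_mult_distr.
  pose proof (pow_lt q m ltac:(lra)).
  assert (q ^ m <= 1) by (rewrite <- (pow1 m); apply pow_incr; lra).
  apply Rmult_le_compat; [apply pow2_ge_0|apply pow2_ge_0| |exact Y].
  simpl; nra.
- rewrite sum_f_R0_scal_l.
  replace (B * K / (1 - q) ^ 2 * X) with (B * (K / (1 - q) * X) * / (1 - q))
    by (field; lra).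
  apply Rmult_le_compat_l; [|apply geom_sum_le; lra].
  apply Rmult_le_pos; [lra|]; apply Rmult_le_pos; [|lra].
  apply Rmult_le_pos; lra.
Qed.

(** * Transfer from unweighted to weighted bounds *)

(** Take for [w k] the maximum of [beta j] over [k <= j <= M], and 0 beyond [M] so that the boundary
    term of Abel summation vanishes. That [w k] is attained at some [j >= k] is what lets a
    condition on [beta] be applied to [w]. *)
Lemma nonincreasing_majorant (beta : nat -> R) M : (forall n, 0 < beta n) ->
  exists w : nat -> R,
    (forall k, w (S k) <= w k) /\ (forall k, (M < k)%nat -> w k = 0) /\
    (forall k, 0 <= w k) /\
    (forall k, (k <= M)%nat -> beta k <= w k) /\
    (forall k, (k <= M)%nat -> exists j, (k <= j)%nat /\ w k = beta j).
Proof.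
revert beta; induction M as [|M IH]; intros beta Hb.
- exists (fun k => match k with O => beta 0%nat | S _ => 0 end).
  pose proof (Hb 0%nat) as H0; repeat split.
  + intros [|k]; lra.
  + intros [|k] Hk; [lia|reflexivity].
  + intros [|k]; lra.
  + intros k Hk; replace k with 0%nat by lia; lra.
  + intros k Hk; exists 0%nat; replace k with 0%nat by lia; auto.
- destruct (IH (fun k => beta (S k)) (fun k => Hb (S k))) as (w & W1 & W2 & W3 & W4 & W5).
  exists (fun k => match k with O => Rmax (beta 0%nat) (w 0%nat) | S k' => w k' end).
  repeat split.
  + intros [|k]; [apply Rmax_r|apply W1].
  + intros [|k] Hk; [lia|apply W2; lia].
  + intros [|k]; [eapply Rle_trans; [apply (W3 0%nat)|apply Rmax_r]|apply W3].
  + intros [|k] Hk; [apply Rmax_l|apply W4; lia].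
  + intros [|k] Hk.
    * destruct (Rmax_case_strong (beta 0%nat) (w 0%nat)
        (fun r => r = beta 0%nat \/ r = w 0%nat)) as [E|E]; auto; rewrite E.
      -- exists 0%nat; auto.
      -- destruct (W5 0%nat ltac:(lia)) as [j [_ Hj]]; exists (S j); split; [lia|exact Hj].
    * destruct (W5 k ltac:(lia)) as [j [Hj1 Hj]]; exists (S j); split; [lia|exact Hj].
Qed.

Lemma abel_summation (w t : nat -> R) M :
  sum_f_R0 (fun m => w m * t m) M =
  sum_f_R0 (fun k => (w k - w (S k)) * sum_f_R0 t k) M + w (S M) * sum_f_R0 t M.
Proof.
induction M as [|M IH]; [simpl; ring|].
rewrite !tech5, IH; simpl; ring.
Qed.

Lemma sum_f_R0_switch (u : nat -> nat -> R) m n :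
  sum_f_R0 (fun i => sum_f_R0 (u i) n) m =
  sum_f_R0 (fun j => sum_f_R0 (fun i => u i j) m) n.
Proof.
induction m as [|m IH]; [reflexivity|].
simpl; rewrite IH, <- plus_sum; reflexivity.
Qed.

(* Kacnel'son's argument: domination of the partial sums transfers to weighted sums,
   by Abel summation against a nonincreasing majorant of the weight. *)
Lemma weighted_domination (beta t y : nat -> R) (act : nat -> nat -> bool) L Cd N M :
  (forall n, 0 < beta n) -> (forall m, 0 <= t m) -> (forall n, 0 <= y n) ->
  0 <= L -> 0 <= Cd ->
  (forall n k j, act n k = true -> (k <= j)%nat -> act n j = true) ->
  (forall n m, act n m = true -> beta m <= Cd * beta n) ->
  (forall k, sum_f_R0 t k <= L * sum_f_R0 (fun n => if act n k then y n else 0) N) ->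
  sum_f_R0 (fun m => beta m * t m) M
  <= L * Cd * sum_f_R0 (fun n => beta n * y n) N.
Proof.
intros Hb Ht Hy HL HC Hmon Hact Hdom.
destruct (nonincreasing_majorant beta M Hb) as (w & W1 & W2 & W3 & W4 & W5).
apply Rle_trans with (sum_f_R0 (fun m => w m * t m) M).
{ apply sum_Rle; intros m Hm; apply Rmult_le_compat_r; auto. }
rewrite abel_summation, (W2 (S M)) by lia; rewrite Rmult_0_l, Rplus_0_r.
apply Rle_trans with (sum_f_R0 (fun k => sum_f_R0 (fun n =>
   L * (y n * (if act n k then w k - w (S k) else 0))) N) M).
{ apply sum_Rle; intros k _.
  pose proof (W1 k) as Wk.
  eapply Rle_trans; [apply Rmult_le_compat_l; [lra|apply Hdom]|].
  rewrite <- sum_f_R0_scal_l, <- sum_f_R0_scal_l; right; apply sum_eq; intros n _.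
  destruct (act n k); ring. }
rewrite sum_f_R0_switch, <- sum_f_R0_scal_l; apply sum_Rle; intros n _.
rewrite sum_f_R0_scal_l, sum_f_R0_scal_l.
set (b := Cd * beta n).
assert (Hb0 : 0 <= b) by (apply Rmult_le_pos; [lra|left; apply Hb]).
(* [w k] is some [beta j] with [j >= k]; activity persists from [k] to [j], so the comparison with
   [beta n] is available at [j]. *)
assert (Hw : forall k, act n k = true -> w k <= b).
{ intros k Hk; destruct (le_lt_dec k M) as [H|H]; [|rewrite W2 by lia; lra].
  destruct (W5 k H) as (j & Hj & ->); apply Hact; eauto. }
(* The active indices form a final segment, so the sum telescopes from the first active index, where
   [w] is at most [b]. *)
assert (F : forall k, sum_f_R0 (fun k => if act n k then w k - w (S k) else 0) k
                      <= if act n k then b - w (S k) else 0).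
{ induction k as [|k IHk].
  - simpl; pose proof (Hw 0%nat); destruct (act n 0%nat); [|lra].
    specialize (H eq_refl); lra.
  - rewrite tech5; pose proof (Hw (S k)) as Hwk; pose proof (Hmon n k (S k)) as Hm.
    destruct (act n (S k)).
    + specialize (Hwk eq_refl); destruct (act n k); lra.
    + destruct (act n k); [|lra].
      specialize (Hm eq_refl ltac:(lia)); discriminate. }
specialize (F M); pose proof (W3 (S M)).
apply Rle_trans with (L * (y n * b)).
- apply Rmult_le_compat_l; [lra|]; apply Rmult_le_compat_l; [apply Hy|].
  eapply Rle_trans; [exact F|]; destruct (act n M); lra.
- right; unfold b; ring.
Qed.

(** * Splitting off the band and bounding the sections *)

Lemma powcoef_band_small c :
  l2_contraction c -> c 0%nat = RtoC 0 -> Cmod (c 1%nat) < 1 ->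
  exists d q, 0 < d /\ 0 < q < 1 /\
    forall m n, INR m <= (1 + d) * INR n -> Cmod (powcoef c n m) <= q ^ m * q ^ n.
Proof.
intros Hc H0 H1.
destruct (schwarz_majorant c Hc H0 H1) as (rho & r & Hrho & Hr & Hmaj).
assert (Hl : ln rho < 0) by (rewrite <- ln_1; apply ln_increasing; lra).
assert (Hl' : ln r < 0) by (rewrite <- ln_1; apply ln_increasing; lra).
set (l := - ln rho); set (lam := - ln r).
assert (Hlp : 0 < l) by (unfold l; lra).
assert (Hlam : 0 < lam) by (unfold lam; lra).
(* On the band, [(r rho)^n / rho^m] is at most [exp ((l * d - lam) * n)]. This [d] spends half of
   [lam]; the other half equals [mu * (2 + d)], which pays for [q^m * q^n] with [q = exp (- mu)],
   since [m + n <= (2 + d) n]. *)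
set (d := lam / (2 * l)).
assert (Hd : 0 < d) by (unfold d; apply Rdiv_lt_0_compat; lra).
set (mu := lam / (2 * (2 + d))).
assert (Hmu : 0 < mu) by (unfold mu; apply Rdiv_lt_0_compat; lra).
exists d, (exp (- mu)); split; [exact Hd|]; split.
{ split; [apply exp_pos|]; rewrite <- exp_0; apply exp_increasing; lra. }
intros m n Hmn.
pose proof (powcoef_majorant c rho (r * rho) n m ltac:(lra) Hmaj) as P.
rewrite Rpow_mult_distr in P.
replace rho with (exp (- l)) in P by (unfold l; rewrite Ropp_involutive; apply exp_ln; lra).
replace r with (exp (- lam)) in P
  by (unfold lam; rewrite Ropp_involutive; apply exp_ln; lra).
rewrite <- !exp_INR_mult, <- exp_plus in P.
rewrite <- !exp_INR_mult, <- exp_plus.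
apply Rmult_le_reg_r with (exp (INR m * - l)); [apply exp_pos|].
eapply Rle_trans; [exact P|]; rewrite <- exp_plus; apply exp_monotone.
assert (E1 : l * d = lam / 2) by (unfold d; field; lra).
assert (E2 : mu * (2 + d) = lam / 2) by (unfold mu; field; lra).
pose proof (pos_INR n).
assert (A1 : l * INR m <= l * ((1 + d) * INR n)) by (apply Rmult_le_compat_l; lra).
assert (A2 : mu * INR m <= mu * ((1 + d) * INR n)) by (apply Rmult_le_compat_l; lra).
replace (l * ((1 + d) * INR n)) with (l * INR n + (l * d) * INR n) in A1 by ring.
replace (mu * ((1 + d) * INR n)) with (mu * (2 + d) * INR n - mu * INR n) in A2 by ring.
rewrite E1 in A1; rewrite E2 in A2; lra.
Qed.

Lemma Cmod_plus_sq_le (a b : C) : Cmod (a + b) ^ 2 <= 2 * Cmod a ^ 2 + 2 * Cmod b ^ 2.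
Proof.
pose proof (Cmod_triangle a b); pose proof (Cmod_ge_0 (a + b)).
apply Rle_trans with ((Cmod a + Cmod b) ^ 2); [apply pow_incr; lra|].
pose proof (pow2_ge_0 (Cmod a - Cmod b)); nra.
Qed.

(** Boundedness of the composition matrix on the weighted space, tested on polynomials of degree [N]
    and output degrees up to [M]; [M0] is uniform in both, so limits can be taken later. *)
Definition sections_bounded (beta : nat -> R) (c : nat -> C) : Prop :=
  exists M0, 0 <= M0 /\ forall x N M,
    sum_f_R0 (fun m => beta m * Cmod (compcoef c x N m) ^ 2) M
    <= M0 * sum_f_R0 (fun n => beta n * Cmod (x n) ^ 2) N.

Lemma sections_bounded_of_small_derivative (beta : nat -> R) B c :
  (forall n, 0 < beta n) -> (forall n, beta n <= B) -> subexponential beta ->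
  (forall delta, 0 < delta -> exists Cd, 0 < Cd /\
     forall m n, (1 + delta) * INR n < INR m -> beta m <= Cd * beta n) ->
  l2_contraction c -> c 0%nat = RtoC 0 -> Cmod (c 1%nat) < 1 ->
  sections_bounded beta c.
Proof.
intros Hb HB Hsub Hgap Hc H0 H1.
destruct (powcoef_band_small c Hc H0 H1) as (d & q & Hd & Hq & Hband).
destruct (Hsub q Hq) as (K & HK & HKq).
destruct (Hgap d Hd) as (Cd & HCd & Hgapd).
set (act := fun n m : nat => if Rlt_dec ((1 + d) * INR n) (INR m) then true else false).
assert (Hact : forall n m, act n m = true -> (1 + d) * INR n < INR m).
{ intros n m; unfold act; destruct Rlt_dec; [auto|discriminate]. }
set (e := fun m n => if act n m then RtoC 0 else powcoef c n m).
set (T := fun (x : nat -> C) N m =>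
  Csum (fun n => ((if act n m then powcoef c n m else RtoC 0) * x n)%C) N).
set (E := fun (x : nat -> C) N m => Csum (fun n => (e m n * x n)%C) N).
assert (HTE : forall x N m, compcoef c x N m = (T x N m + E x N m)%C).
{ intros x N m; unfold compcoef, T, E; rewrite <- Csum_plus; apply Csum_ext; intros n _.
  unfold e; destruct (act n m); ring. }
assert (He : forall m n, Cmod (e m n) <= q ^ m * q ^ n).
{ intros m n; unfold e, act; destruct Rlt_dec as [Hl|Hl].
  - rewrite Cmod_0; apply Rmult_le_pos; apply pow_le; lra.
  - apply Hband; lra. }
set (K1 := 1 * 1 / (1 - q) ^ 2).
set (K2 := B * K / (1 - q) ^ 2).
assert (Hq2 : 0 < (1 - q) ^ 2) by (apply pow_lt; lra).
assert (HK1 : 0 < K1) by (unfold K1; apply Rdiv_lt_0_compat; lra).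
assert (HB0 : 0 < B) by (pose proof (Hb 0%nat); pose proof (HB 0%nat); lra).
assert (HK2 : 0 < K2)
  by (unfold K2; apply Rdiv_lt_0_compat; [apply Rmult_lt_0_compat|]; lra).
assert (E1 : forall x N M, sum_f_R0 (fun m => Cmod (E x N m) ^ 2) M
          <= K1 * sum_f_R0 (fun n => Cmod (x n) ^ 2) N).
{ intros x N M.
  rewrite (sum_eq (fun m => Cmod (E x N m) ^ 2)
             (fun m => 1 * Cmod (E x N m) ^ 2)) by (intros; ring).
  rewrite (sum_eq (fun m => Cmod (x m) ^ 2)
             (fun m => 1 * Cmod (x m) ^ 2)) by (intros; ring).
  apply (geometric_matrix_bounded e (fun _ => 1) 1 1 q x N M); auto; try lra.
  - intros; lra.
  - intros; lra.
  - intro n; rewrite Rmult_1_l, <- (pow1 n); apply pow_incr; lra. }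
assert (E2 : forall x N M, sum_f_R0 (fun m => beta m * Cmod (E x N m) ^ 2) M
          <= K2 * sum_f_R0 (fun n => beta n * Cmod (x n) ^ 2) N).
{ intros x N M; now apply (geometric_matrix_bounded e beta B K q x N M). }
(* From [T = A - E]: the squared l^2 norm of [T] is at most twice that of [A], which is at most 1,
   plus twice that of [E]. *)
set (L := 2 + 2 * K1).
exists (2 * (L * Cd) + 2 * K2); split.
{ assert (0 < L * Cd) by (apply Rmult_lt_0_compat; unfold L; lra); lra. }
intros x N M.
assert (T1 : sum_f_R0 (fun m => beta m * Cmod (T x N m) ^ 2) M
             <= L * Cd * sum_f_R0 (fun n => beta n * Cmod (x n) ^ 2) N).
{ apply (weighted_domination beta (fun m => Cmod (T x N m) ^ 2)
           (fun n => Cmod (x n) ^ 2) act); auto; try (unfold L; lra).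
  - intro; apply sqnorm_ge_0.
  - intro; apply sqnorm_ge_0.
  - intros n k j Hk Hj; apply Hact in Hk; apply le_INR in Hj.
    unfold act; destruct Rlt_dec; [reflexivity|lra].
  - intro k.
    (* Rows [m <= k] of [T] only see inputs active at [m], hence at [k]. Replacing [x] by [xk]
       leaves those rows of [T] unchanged, and the l^2 bound then involves active inputs only. *)
    set (xk := fun n => if act n k then x n else RtoC 0).
    rewrite (sum_eq (fun n => if act n k then Cmod (x n) ^ 2 else 0)
               (fun n => Cmod (xk n) ^ 2)).
    2:{ intros n _; unfold xk; destruct (act n k); [reflexivity|].
        rewrite Cmod_0; ring. }
    apply Rle_trans with (sum_f_R0 (fun m => 2 * Cmod (compcoef c xk N m) ^ 2 +
                                       2 * Cmod (E xk N m) ^ 2) k).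
    + apply sum_Rle; intros m Hm.
      replace (T x N m) with (compcoef c xk N m + - E xk N m)%C.
      { eapply Rle_trans; [apply Cmod_plus_sq_le|rewrite Cmod_opp; lra]. }
      rewrite HTE; replace (T x N m) with (T xk N m); [ring|].
      unfold T; apply Csum_ext; intros n _; unfold xk.
      destruct (act n m) eqn:Ea; [|ring].
      destruct (act n k) eqn:Eb; [reflexivity|exfalso].
      apply Hact in Ea; apply le_INR in Hm.
      unfold act in Eb; destruct Rlt_dec; [discriminate|lra].
    + rewrite plus_sum, !sum_f_R0_scal_l.
      pose proof (littlewood_subordination c xk N k Hc H0).
      pose proof (E1 xk N k); unfold L; lra. }
apply Rle_trans with (sum_f_R0 (fun m => 2 * (beta m * Cmod (T x N m) ^ 2) +
                                         2 * (beta m * Cmod (E x N m) ^ 2)) M).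
{ apply sum_Rle; intros m _; rewrite HTE.
  pose proof (Cmod_plus_sq_le (T x N m) (E x N m)); pose proof (Hb m); nra. }
rewrite plus_sum, !sum_f_R0_scal_l; pose proof (E2 x N M); lra.
Qed.

Lemma sections_bounded_rotation beta c :
  (forall n, 0 < beta n) -> l2_contraction c ->
  (forall k, k <> 1%nat -> c k = RtoC 0) -> sections_bounded beta c.
Proof.
intros Hb Hc Hrot; exists 1; split; [lra|]; intros x N M.
(* [N] and [M] are unrelated, and output degrees above [N] vanish; extending the input by zero makes
   the two sums comparable. *)
set (u := fun m => beta m * Cmod (trunc N x m) ^ 2).
assert (Hu : forall k, 0 <= u k).
{ intro k; apply Rmult_le_pos; [left; apply Hb|apply sqnorm_ge_0]. }
rewrite Rmult_1_l; apply Rle_trans with (sum_f_R0 u M).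
- apply sum_Rle; intros m _; unfold u; apply Rmult_le_compat_l; [left; apply Hb|].
  apply pow_incr; split; [apply Cmod_ge_0|].
  destruct (le_lt_dec m N) as [H|H].
  + rewrite trunc_le by auto; unfold compcoef; rewrite (Csum_single _ N m H).
    * rewrite Cmod_mult; pose proof (powcoef_le_1 c m m Hc).
      pose proof (Cmod_ge_0 (x m)); nra.
    * intros n _ Hn; rewrite rotation_powcoef_diag by auto; ring.
  + rewrite trunc_gt by auto; right; f_equal; unfold compcoef.
    apply Csum_zero; intros n Hn; rewrite rotation_powcoef_diag by (auto; lia); ring.
- apply Rle_trans with (sum_f_R0 u (M + N)); [apply sum_f_R0_le_extend; auto; lia|].
  rewrite (sum_f_R0_extend u N) by
    first [lia | intros k Hk; unfold u; rewrite trunc_gt, Cmod_0 by lia; ring].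
  right; apply sum_eq; intros n Hn; unfold u; now rewrite trunc_le.
Qed.

(** * Taylor coefficients of the composition *)

Lemma nonneg_series_bounded (u : nat -> R) A :
  (forall k, 0 <= u k) -> (forall n, sum_f_R0 u n <= A) ->
  ex_series u /\ Series u <= A.
Proof.
intros Hu HA.
assert (Hex : ex_series u).
{ destruct (ex_finite_lim_seq_incr (sum_f_R0 u) A) as [l Hl]; auto.
  - intro n; simpl; specialize (Hu (S n)); lra.
  - exists l; now apply is_series_sum_f_R0. }
split; [exact Hex|].
apply Series_correct, is_series_sum_f_R0 in Hex.
now apply (is_lim_seq_le (sum_f_R0 u) (fun _ => A) (Series u) A HA Hex
             (is_lim_seq_const A)).
Qed.

Lemma partial_sum_le_Series (u : nat -> R) n :
  (forall k, 0 <= u k) -> ex_series u -> sum_f_R0 u n <= Series u.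
Proof.
intros Hu Hex; apply Series_correct, is_series_sum_f_R0 in Hex.
apply (is_lim_seq_incr_compare (sum_f_R0 u) _ Hex).
intro k; simpl; specialize (Hu (S k)); lra.
Qed.

(** Cauchy-Schwarz against [beta], the dual sum of [|z|^(2m) / beta m] being geometric by
    subexponentiality; [E] is independent of the number of terms. *)
Lemma point_evaluation_bounded beta z :
  (forall n, 0 < beta n) -> subexponential beta -> in_disk z ->
  exists E, 0 < E /\ forall x L,
    Cmod (Csum (fun m => (z ^ m * x m)%C) L) ^ 2
    <= E * sum_f_R0 (fun m => beta m * Cmod (x m) ^ 2) L.
Proof.
intros Hb Hsub Hz; unfold in_disk in Hz; pose proof (Cmod_ge_0 z) as Hz0.
(* The midpoint replaces [Cmod z], which may be 0, while [subexponential] asks for a positive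
   ratio. *)
destruct (Hsub ((1 + Cmod z) / 2)) as (K & HK & HKt); [lra|].
exists (K * / (1 - Cmod z)); split.
{ apply Rmult_lt_0_compat; [lra|apply Rinv_0_lt_compat; lra]. }
intros x L.
apply Rle_trans with (sum_f_R0 (fun m => Cmod z ^ m * Cmod (x m)) L ^ 2).
{ apply pow_incr; split; [apply Cmod_ge_0|].
  eapply Rle_trans; [apply Cmod_Csum|right; apply sum_eq; intros m _].
  now rewrite Cmod_mult, Cmod_pow. }
eapply Rle_trans; [apply (weighted_Cauchy_Schwarz _ _ beta _ Hb)|].
apply Rmult_le_compat_r.
{ apply cond_pos_sum; intro n; apply Rmult_le_pos; [left; apply Hb|apply sqnorm_ge_0]. }
apply Rle_trans with (K * sum_f_R0 (fun m => Cmod z ^ m) L).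
- rewrite <- sum_f_R0_scal_l; apply sum_Rle; intros m _.
  pose proof (Hb m); specialize (HKt m); pose proof (pow_le (Cmod z) m Hz0).
  assert (Cmod z ^ m <= ((1 + Cmod z) / 2) ^ m) by (apply pow_incr; lra).
  apply Rmult_le_reg_r with (beta m); [lra|].
  replace ((Cmod z ^ m) ^ 2 / beta m * beta m) with (Cmod z ^ m * Cmod z ^ m)
    by (field; lra).
  replace (K * Cmod z ^ m * beta m) with (Cmod z ^ m * (K * beta m)) by ring.
  apply Rmult_le_compat_l; lra.
- apply Rmult_le_compat_l; [lra|apply geom_sum_le; lra].
Qed.

(** Triangularity: powers above [m] have no term of degree [m], so [compcoef c a m m] is already the
    coefficient for the full series. *)
Lemma compcoef_stationary c a N m :
  c 0%nat = RtoC 0 -> (m <= N)%nat -> compcoef c a N m = compcoef c a m m.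
Proof.
intros H0 HN; apply Csum_extend; [exact HN|].
intros k Hk; rewrite powcoef_lower by auto; ring.
Qed.

Lemma compcoef_pseries phi c a N z :
  taylor_on_disk phi c -> l2_contraction c -> in_disk z ->
  Ccv (Csum (fun m => (z ^ m * compcoef c a N m)%C))
      (Csum (fun n => (phi z ^ n * a n)%C) N).
Proof.
intros Ht Hc Hz.
apply Ccv_ext with (fun L => Csum (fun n =>
   (a n * Csum (fun m => (z ^ m * powcoef c n m)%C) L)%C) N).
{ intro L.
  rewrite (Csum_ext _ (fun n => Csum (fun m => (a n * (z ^ m * powcoef c n m))%C) L))
    by (intros; symmetry; apply Csum_mult_l).
  rewrite Csum_switch; apply Csum_ext; intros m _.
  unfold compcoef; rewrite <- Csum_mult_l; apply Csum_ext; intros; ring. }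
rewrite (Csum_ext _ (fun n => (a n * phi z ^ n)%C)) by (intros; ring).
apply (Ccv_Csum (fun n L => (a n * Csum (fun m => (z ^ m * powcoef c n m)%C) L)%C)
         (fun n => (a n * phi z ^ n)%C)).
intros n _; apply (Ccv_scal (a n) _ (phi z ^ n)%C); now apply powcoef_pseries.
Qed.

Lemma taylor_at_0 f c : taylor_on_disk f c -> c 0%nat = f (RtoC 0).
Proof.
intro Ht.
assert (Hd : in_disk (RtoC 0)) by (unfold in_disk; rewrite Cmod_0; lra).
apply (Ccv_unique (Csum (fun k => (RtoC 0 ^ k * c k)%C))).
- apply Ccv_eventually_const with 0%nat; intros n _.
  rewrite (Csum_single _ n 0) by
    first [lia | intros [|k] _ Hk; [lia|rewrite Cpow_S; ring]].
  simpl; ring.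
- apply (proj1 (is_pseries_Ccv _ _ _) (Ht _ Hd)).
Qed.

(* The Taylor coefficients of f o phi are the limits, stationary in each degree, of those of
   f_N o phi, f_N the Taylor polynomials of f; bounded point evaluation makes the
   convergence of the partial sums uniform in the truncation. *)
Lemma comp_taylor beta phi c f a :
  (forall n, 0 < beta n) -> subexponential beta -> sections_bounded beta c ->
  taylor_on_disk phi c -> (forall z, in_disk z -> in_disk (phi z)) ->
  l2_contraction c -> c 0%nat = RtoC 0 -> in_H2 beta f a ->
  taylor_on_disk (fun z => f (phi z)) (fun m => compcoef c a m m).
Proof.
intros Hb Hsub (M0 & HM0 & Hbd) Ht Hself Hc H0 [Hf Hex] z Hz.
destruct (point_evaluation_bounded beta z Hb Hsub Hz) as (E & HE & Hev).
apply is_pseries_Ccv; intros eps Heps.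
set (w := phi z); set (b := fun m => compcoef c a m m).
assert (Hu : forall k, 0 <= wterm beta a k).
{ intro k; apply Rmult_le_pos; [apply sqnorm_ge_0|left; apply Hb]. }
pose proof (proj1 (is_series_sum_f_R0 _ _) (Series_correct _ Hex)) as Hlim.
apply is_lim_seq_spec in Hlim.
(* A tail of size [(eps / 3)^2 / A] becomes at most [(eps / 3)^2] after the section bound and the
   point evaluation; the 1 keeps [A] positive when [M0 = 0]. *)
set (A := E * (M0 + 1)).
assert (HA : 0 < A) by (unfold A; apply Rmult_lt_0_compat; lra).
assert (Hpos : 0 < (eps / 3) ^ 2 / A).
{ apply Rdiv_lt_0_compat; [apply pow_lt; lra|exact HA]. }
destruct (Hlim (mkposreal _ Hpos)) as [N1 HN1]; simpl in HN1.
pose proof (proj1 (is_pseries_Ccv _ _ _) (Hf w (Hself z Hz))) as Hfw.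
destruct (Hfw (eps / 3)) as [N2 HN2]; [lra|].
set (N := (N1 + N2)%nat).
specialize (HN1 N ltac:(unfold N; lia)); specialize (HN2 N ltac:(unfold N; lia)).
destruct (compcoef_pseries phi c a N z Ht Hc Hz (eps / 3)) as [N3 HN3]; [lra|].
exists N3; intros L HL; specialize (HN3 L HL).
fold w in HN3.
set (fN := Csum (fun n => (w ^ n * a n)%C) N) in *.
set (s := Csum (fun m => (z ^ m * compcoef c a N m)%C) L) in *.
assert (D : Cmod (Csum (fun m => (z ^ m * b m)%C) L - s) <= eps / 3).
{ unfold s; rewrite <- Csum_minus.
  (* The difference to be bounded is the composition of the tail of [a] beyond [N]; length [N + L]
     makes all degrees up to [L] stationary. The estimate holds for every [L], so [N] can be fixed
     before [N3]. *)
  set (y := fun n => if Nat.leb n N then RtoC 0 else a n).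
  rewrite (Csum_ext _ (fun m => (z ^ m * compcoef c y (N + L) m)%C)).
  2:{ intros m Hm.
      assert (Hy : compcoef c y (N + L) m
                   = (compcoef c a (N + L) m - compcoef c (trunc N a) (N + L) m)%C).
      { unfold compcoef; rewrite <- Csum_minus; apply Csum_ext; intros n _.
        unfold y, trunc; destruct (n <=? N)%nat; ring. }
      rewrite Hy, (compcoef_stationary c a (N + L)) by (auto; lia).
      replace (compcoef c (trunc N a) (N + L) m) with (compcoef c a N m);
        [unfold b; ring|].
      unfold compcoef; rewrite (Csum_extend _ N (N + L)) by
        first [lia | intros; rewrite trunc_gt by lia; ring].
      apply Csum_ext; intros n Hn; now rewrite trunc_le. }
  assert (Hy2 : sum_f_R0 (fun n => beta n * Cmod (y n) ^ 2) (N + L)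
                <= (eps / 3) ^ 2 / A).
  { apply Rle_trans with (sum_f_R0 (wterm beta a) (N + L) - sum_f_R0 (wterm beta a) N).
    - generalize L; intro L'; induction L' as [|L' IH].
      + rewrite Nat.add_0_r, Rminus_diag.
        right; apply sum_eq_R0; intros n Hn; unfold y.
        rewrite (proj2 (Nat.leb_le n N) Hn), Cmod_0; ring.
      + rewrite Nat.add_succ_r, !tech5; unfold y at 2.
        rewrite (proj2 (Nat.leb_gt (S (N + L')) N)) by lia.
        unfold wterm at 2; lra.
    - pose proof (partial_sum_le_Series _ (N + L) Hu Hex).
      apply Rabs_def2 in HN1; lra. }
  apply Rsqr_incr_0_var; [|lra]; rewrite !Rsqr_pow2.
  eapply Rle_trans; [apply Hev|].
  apply Rle_trans with (E * (M0 * ((eps / 3) ^ 2 / A))).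
  - apply Rmult_le_compat_l; [lra|].
    eapply Rle_trans; [|apply Rmult_le_compat_l; [exact HM0|exact Hy2]].
    apply Hbd.
  - apply Rle_trans with (A * ((eps / 3) ^ 2 / A)); [|right; field; lra].
    rewrite <- Rmult_assoc; apply Rmult_le_compat_r; [lra|].
    unfold A; apply Rmult_le_compat_l; lra. }
change (Cmod (Csum (fun m => (z ^ m * b m)%C) L - f w) < eps).
replace (Csum (fun m => (z ^ m * b m)%C) L - f w)%C
  with ((Csum (fun m => (z ^ m * b m)%C) L - s) + ((s - fN) + (fN - f w)))%C by ring.
eapply Rle_lt_trans; [apply Cmod_triangle|].
pose proof (Cmod_triangle (s - fN) (fN - f w)); lra.
Qed.

Theorem mainTheorem9 (beta : nat -> R) :
  (forall n : nat, 0 < beta n) ->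
  (exists B : R, forall n : nat, beta n <= B) ->
  poly_minoration beta ->
  (forall delta : R, 0 < delta -> exists Cd : R, 0 < Cd /\
     forall m n : nat, (1 + delta) * INR n < INR m -> beta m <= Cd * beta n) ->
  forall phi : C -> C, symbol phi -> phi (RtoC 0) = RtoC 0 ->
  comp_bounded beta phi.
Proof.
intros Hb [B HB] Hmin Hgap phi ((c & Ht) & Hself & _) Hphi0.
pose proof (poly_minoration_subexponential beta Hb Hmin) as Hsub.
pose proof (self_map_l2_contraction phi c Ht Hself) as Hc.
assert (H0 : c 0%nat = RtoC 0) by (rewrite (taylor_at_0 phi c Ht); exact Hphi0).
assert (Hsec : sections_bounded beta c).
{ pose proof (powcoef_le_1 c 1 1 Hc) as H1; simpl powcoef in H1.
  rewrite conv_one_r in H1.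
  destruct (Rle_lt_or_eq_dec _ _ H1) as [H|H].
  - now apply (sections_bounded_of_small_derivative beta B).
  - apply sections_bounded_rotation; auto.
    intros k Hk; now apply unimodular_derivative_rotation. }
pose proof Hsec as (M0 & HM0 & Hbd).
exists M0; split; [exact HM0|]; intros f a Ha.
exists (fun m => compcoef c a m m).
pose proof (comp_taylor beta phi c f a Hb Hsub Hsec Ht Hself Hc H0 Ha) as Htay.
destruct Ha as [Hf Hex].
assert (Hu : forall u k, 0 <= wterm beta u k).
{ intros u k; apply Rmult_le_pos; [apply sqnorm_ge_0|left; apply Hb]. }
destruct (nonneg_series_bounded (wterm beta (fun m => compcoef c a m m))
            (M0 * H2_norm2 beta a)) as [Hex' Hle]; [apply Hu| |].
(* In the square section with [N = M], every degree up to [M] is already stationary. *)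
- intro M; apply Rle_trans with
    (sum_f_R0 (fun m => beta m * Cmod (compcoef c a M m) ^ 2) M).
  + right; apply sum_eq; intros m Hm; unfold wterm.
    rewrite (compcoef_stationary c a M) by auto; ring.
  + eapply Rle_trans; [apply Hbd|]; apply Rmult_le_compat_l; [exact HM0|].
    unfold H2_norm2; eapply Rle_trans; [|apply (partial_sum_le_Series _ M (Hu a) Hex)].
    right; apply sum_eq; intros; unfold wterm; ring.
- split; [split; assumption|exact Hle].
Qed.
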